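(* Let $H$ be a pointed Hopf algebra over a field $\mathbb{K}$ with invertible antipode and finite group $G=G(H)$ of grouplike elements. If $X_1,X_2,\dots,X_n$ is a complete set of representatives of the equivalence classes of $\mathcal{P}_1(G)$ under $\sim$, then $$H_{par}=\bigoplus_{k=1}^{n} H_{par}\,\Gamma_{X_k},$$ where $H_{par}\Gamma_{X_k}$ is a (two-sided) ideal of $H_{par}$ for all $k=1,2,\dots,n$.
   Context: Sweedler notation $\Delta(h)=h_{1}\otimes h_{2}$ is used; $S$ is the antipode of $H$. A Hopf algebra is pointed if all its simple subcoalgebras are one-dimensional. The algebra $H_{par}$ is the quotient of the tensor algebra $T(H)$ by the relations $1_H=1_{T(H)}$, $h\otimes k_{1}\otimes S(k_{2})=hk_{1}\otimes S(k_{2})$ and $h_{1}\otimes S(h_{2})\otimes k=h_{1}\otimes S(h_{2})k$ for all $h,k\in H$. The class of $h\in H$ in $H_{par}$ is denoted $[h]$. For $h\in H$ put $\varepsilon_h=[h_{1}][S(h_{2})]\in H_{par}$. $\mathcal{P}_1(G)=\{X\subseteq G\mid 1_H\in X\}$. For $X\in\mathcal{P}_1(G)$, $$P_X=\prod_{x\in X}\varepsilon_x\prod_{y\in G\setminus X}(1-\varepsilon_y)\in H_{par}$$ (the elements $\varepsilon_g$, $g\in G$, are commuting idempotents). For $X,Y\in\mathcal{P}_1(G)$, write $X\sim Y$ if there exists $g\in G$ with $g^{-1}\in X$ and $gX=Y$; this is an equivalence relation. For $X\in\mathcal{P}_1(G)$, $\Gamma_X=\sum_{Y\sim X}P_Y$.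 *)

(* Defs.v *)
From HB Require Import structures.
From mathcomp Require Import all_boot all_order all_algebra.
From mathcomp Require Import finmap.
From mathcomp Require Import boolp classical_sets functions cardinality.
From mathcomp.multinomials Require Import monalg.

Set Implicit Arguments.
Unset Strict Implicit.
Unset Printing Implicit Defensive.

Import GRing.Theory.
Local Open Scope ring_scope.
Local Open Scope quotient_scope.

(** Key locking the operations of quotient structures, so that conversion does not
    unfold them. *)
Fact quot_key : unit. Proof. exact: tt. Qed.

Section Span.
Context (K : fieldType) (V : lmodType K).

Inductive lspan (S : set V) : set V :=
| lspan0 : lspan S 0
| lspanZD (a : K) (x y : V) : S x -> lspan S y -> lspan S (a *: x + y).

Lemma lspanS (S : set V) x : S x -> lspan S x.
Proof. by move=> Sx; rewrite -[x]addr0 -[x]scale1r; apply: lspanZD => //; apply: lspan0. Qed.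

Lemma lspanD (S : set V) x y : lspan S x -> lspan S y -> lspan S (x + y).
Proof.
elim=> [|a u v Su _ IH] Sy; first by rewrite add0r.
by rewrite -addrA; apply: lspanZD => //; apply: IH.
Qed.

Lemma lspanZ (S : set V) a x : lspan S x -> lspan S (a *: x).
Proof.
elim=> [|b u v Su _ IH]; first by rewrite scaler0; apply: lspan0.
by rewrite scalerDr scalerA; apply: lspanZD.
Qed.

Definition lspan_pred (S : set V) : {pred V} := fun x => `[< lspan S x >].

Lemma lspan_predE S x : (x \in lspan_pred S) = `[< lspan S x >].
Proof. by []. Qed.

Lemma lspan_pred_zmod S : zmod_closed (lspan_pred S).
Proof.
split=> [|x y]; rewrite !lspan_predE; first by apply/asboolP/lspan0.
move=> /asboolP Sx /asboolP Sy; apply/asboolP.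
by rewrite -scaleN1r; apply: lspanD => //; apply: lspanZ.
Qed.

HB.instance Definition _ S :=
  GRing.isZmodClosed.Build V (lspan_pred S) (lspan_pred_zmod S).

(** [lquot S] is the quotient of [V] by the subspace spanned by [S]. *)
Definition lquot (S : set V) : Type := Quotient.quot (lspan_pred S).

Context (S : set V).
HB.instance Definition _ := Choice.on (lquot S).
HB.instance Definition _ := GRing.Zmodule.on (lquot S).
HB.instance Definition _ := EqQuotient.on (lquot S).

Definition lproj : V -> lquot S :=
  locked_with quot_key (fun x : V => \pi_(Quotient.quot (lspan_pred S)) x).
Definition lrepr : lquot S -> V :=
  locked_with quot_key (fun x : Quotient.quot (lspan_pred S) => repr x).

Lemma lprojE x : lproj x = \pi_(Quotient.quot (lspan_pred S)) x.
Proof. by rewrite /lproj locked_withE. Qed.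

Lemma lreprK : cancel lrepr lproj.
Proof. by move=> x; rewrite lprojE /lrepr locked_withE; apply: reprK. Qed.

Lemma lproj_eq x y : lproj x = lproj y <-> lspan S (x - y).
Proof.
split=> [E|Sxy].
  by apply/asboolP; rewrite -lspan_predE Quotient.idealrBE -!lprojE; apply/eqP.
by apply/eqP; rewrite !lprojE -Quotient.idealrBE; apply/asboolP.
Qed.

Lemma lprojB : {morph lproj : x y / x - y}.
Proof. by move=> x y; rewrite !lprojE raddfB. Qed.

Definition lquot_scale : K -> lquot S -> lquot S :=
  locked_with quot_key (fun a x => lproj (a *: lrepr x)).

Lemma lquot_scaleE a x : lquot_scale a (lproj x) = lproj (a *: x).
Proof.
rewrite /lquot_scale locked_withE.
apply/lproj_eq; rewrite -scalerBr; apply: lspanZ; apply/lproj_eq.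
exact: lreprK.
Qed.

Lemma lprojD : {morph lproj : x y / x + y}.
Proof. by move=> x y; rewrite !lprojE raddfD. Qed.

Fact lquot_scaleA a b v :
  lquot_scale a (lquot_scale b v) = lquot_scale (a * b) v.
Proof. by rewrite -[v]lreprK !lquot_scaleE scalerA. Qed.
Fact lquot_scale1 : left_id 1 lquot_scale.
Proof. by move=> v; rewrite -[v]lreprK lquot_scaleE scale1r. Qed.
Fact lquot_scaleDr : right_distributive lquot_scale +%R.
Proof.
move=> a u v; rewrite -[u]lreprK -[v]lreprK -lprojD !lquot_scaleE.
by rewrite -lprojD scalerDr.
Qed.
Fact lquot_scaleDl v : {morph lquot_scale^~ v : a b / a + b}.
Proof. by move=> a b; rewrite -[v]lreprK !lquot_scaleE -lprojD scalerDl. Qed.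

HB.instance Definition _ := GRing.Zmodule_isLmodule.Build K (lquot S)
  lquot_scaleA lquot_scale1 lquot_scaleDr lquot_scaleDl.

Lemma lproj_is_linear : linear lproj.
Proof. by move=> a x y; rewrite lprojD -lquot_scaleE. Qed.

HB.instance Definition _ :=
  GRing.isLinear.Build K V (lquot S) _ lproj lproj_is_linear.

End Span.

Section Tensor.
Context (K : fieldType) (U V : lmodType K).

Definition fpair (u : U) (v : V) : {malg K[(U * V)%type]} := << (u, v) >>.

Inductive tensor_rel : set {malg K[(U * V)%type]} :=
| tensor_rel_l a u u' v :
    tensor_rel (fpair (a *: u + u') v - (a *: fpair u v + fpair u' v))
| tensor_rel_r a u v v' :
    tensor_rel (fpair u (a *: v + v') - (a *: fpair u v + fpair u v')).

Definition tensor : Type := lquot tensor_rel.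
HB.instance Definition _ := GRing.Lmodule.on tensor.

Definition tens (u : U) (v : V) : tensor := lproj tensor_rel (fpair u v).

(** [tlift (u_1 (x) v_1 + ... + u_n (x) v_n) B = B u_1 v_1 + ... + B u_n v_n]
    for a bilinear map [B], see [tlift_tens] and [tlift_linear]. It is only
    meaningful for bilinear [B]; not packaging bilinearity allows Sweedler sums
    to be written for arbitrary expressions. *)
Definition tlift (W : lmodType K) (t : tensor) (B : U -> V -> W) : W :=
  let m : {malg K[(U * V)%type]} := lrepr t in
  \sum_(p <- msupp m) m@_p *: B p.1 p.2.

Section Lift.
Context (W : lmodType K) (B : U -> V -> W).
Hypotheses (linl : forall v, linear (B^~ v)) (linr : forall u, linear (B u)).

Let ext (m : {malg K[(U * V)%type]}) : W :=
  \sum_(p <- msupp m) m@_p *: B p.1 p.2.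

Let extEw (d : {fset U * V}) m : (msupp m `<=` d)%fset ->
  ext m = \sum_(p <- d) m@_p *: B p.1 p.2.
Proof.
move=> le; rewrite /ext (big_fset_incl _ le) => //= x _ /mcoeff_outdom ->.
by rewrite scale0r.
Qed.

Let ext_linear : linear ext.
Proof.
move=> a x y.
pose d := (msupp x `|` msupp y `|` msupp (a *: x + y))%fset.
rewrite !(@extEw d); try by apply/fsubsetP => p ps; rewrite /d !inE ps ?orbT.
rewrite scaler_sumr -big_split /=; apply: eq_bigr => p _.
by rewrite mcoeffD mcoeffZ scalerDl scalerA.
Qed.

Let ext_fpair u v : ext (fpair u v) = B u v.
Proof. by rewrite (extEw (msuppU_le)) big_seq_fset1 mcoeffUU scale1r. Qed.

Let extD x y : ext (x + y) = ext x + ext y.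
Proof. by have := ext_linear 1 x y; rewrite !scale1r. Qed.
Let ext0 : ext 0 = 0.
Proof. by rewrite /ext msupp0 big_seq_fset0. Qed.
Let extZ a x : ext (a *: x) = a *: ext x.
Proof. by have := ext_linear a x 0; rewrite !addr0 ext0 addr0. Qed.
Let extB x y : ext (x - y) = ext x - ext y.
Proof. by rewrite extD -[- y]scaleN1r extZ scaleN1r. Qed.

Let ext_rel m : lspan tensor_rel m -> ext m = 0.
Proof.
elim=> [|a x y Sx _ IH]; first exact: ext0.
rewrite ext_linear IH addr0; case: Sx => [b u u' v|b u v v'].
  by rewrite extB ext_linear !ext_fpair linl subrr scaler0.
by rewrite extB ext_linear !ext_fpair linr subrr scaler0.
Qed.

Let tlift_proj m : tlift (lproj tensor_rel m) B = ext m.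
Proof.
apply/eqP; rewrite -subr_eq0; apply/eqP; rewrite -[tlift _ _]/(ext _) -extB.
by apply: ext_rel; apply/lproj_eq/lreprK.
Qed.

Lemma tlift_tens u v : tlift (tens u v) B = B u v.
Proof. by rewrite tlift_proj ext_fpair. Qed.

Lemma tlift_linear : linear (fun t => tlift t B).
Proof.
move=> a x y; rewrite -[x]lreprK -[y]lreprK -linearP.
by rewrite !tlift_proj ext_linear.
Qed.

End Lift.
End Tensor.

(** Sweedler notation: [\sw_(x, y <- t) e] is the sum of [e] over the summands
    [x (x) y] of [t]. *)
Notation "\sw_ ( x , y <- t ) e" := (tlift t (fun x y => e))
  (at level 41, x name, y name, t at level 100, e at level 41,
   format "\sw_ ( x ,  y  <-  t )  e") : ring_scope.

Section IdealQuotient.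
Context (K : fieldType) (A : algType K) (R : set A).

Definition ideal_gen : set A := [set z | exists a r b, R r /\ z = a * r * b].

(** The quotient of [A] by the two-sided ideal generated by [R]. It is the zero
    ring when [1] is in this ideal. *)
Definition iquot : Type := lquot ideal_gen.
HB.instance Definition _ := GRing.Lmodule.on iquot.

Definition iproj (x : A) : iquot := lproj ideal_gen x.
Lemma iproj_is_linear : linear iproj.
Proof. exact: lproj_is_linear. Qed.
HB.instance Definition _ :=
  GRing.isLinear.Build K A iquot _ iproj iproj_is_linear.
Definition irepr (x : iquot) : A := lrepr x.

Lemma ireprK : cancel irepr iproj. Proof. exact: lreprK. Qed.

Lemma ideal_mull a x : lspan ideal_gen x -> lspan ideal_gen (a * x).
Proof.
elim=> [|k u v [b [r [c [Rr ->]]]] _ IH]; first by rewrite mulr0; apply: lspan0.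
rewrite mulrDr -scalerAr; apply: lspanZD => //.
by exists (a * b), r, c; rewrite !mulrA.
Qed.

Lemma ideal_mulr a x : lspan ideal_gen x -> lspan ideal_gen (x * a).
Proof.
elim=> [|k u v [b [r [c [Rr ->]]]] _ IH]; first by rewrite mul0r; apply: lspan0.
rewrite mulrDl -scalerAl; apply: lspanZD => //.
by exists b, r, (c * a); rewrite !mulrA.
Qed.

Lemma iproj_rel r : R r -> iproj r = 0.
Proof.
move=> Rr; rewrite -(linear0 iproj); apply/lproj_eq; rewrite subr0.
by apply: lspanS; exists 1, r, 1; rewrite mul1r mulr1.
Qed.

Definition iquot_mul : iquot -> iquot -> iquot :=
  locked_with quot_key (fun x y => iproj (irepr x * irepr y)).

Lemma iquot_mulE x y : iquot_mul (iproj x) (iproj y) = iproj (x * y).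
Proof.
rewrite /iquot_mul locked_withE; apply/lproj_eq; set x' := irepr _; set y' := irepr _.
have Ix : lspan ideal_gen (x' - x) by apply/lproj_eq/ireprK.
have Iy : lspan ideal_gen (y' - y) by apply/lproj_eq/ireprK.
have -> : x' * y' - x * y = x' * (y' - y) + (x' - x) * y.
  by rewrite mulrBr mulrBl addrA subrK.
by apply: lspanD; [apply: ideal_mull | apply: ideal_mulr].
Qed.

Fact iquot_mulA : associative iquot_mul.
Proof.
move=> x y z; rewrite -[x]ireprK -[y]ireprK -[z]ireprK.
by rewrite !iquot_mulE mulrA.
Qed.
Fact iquot_mul1 : left_id (iproj 1) iquot_mul.
Proof. by move=> x; rewrite -[x]ireprK iquot_mulE mul1r. Qed.
Fact iquot_1mul : right_id (iproj 1) iquot_mul.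
Proof. by move=> x; rewrite -[x]ireprK iquot_mulE mulr1. Qed.
Fact iquot_mulDl : left_distributive iquot_mul +%R.
Proof.
move=> x y z; rewrite -[x]ireprK -[y]ireprK -[z]ireprK.
by rewrite -(linearD iproj) !iquot_mulE mulrDl (linearD iproj).
Qed.
Fact iquot_mulDr : right_distributive iquot_mul +%R.
Proof.
move=> x y z; rewrite -[x]ireprK -[y]ireprK -[z]ireprK.
by rewrite -(linearD iproj) !iquot_mulE mulrDr (linearD iproj).
Qed.

HB.instance Definition _ := GRing.Zmodule_isPzRing.Build iquot
  iquot_mulA iquot_mul1 iquot_1mul iquot_mulDl iquot_mulDr.

Lemma iprojM : {morph iproj : x y / x * y}.
Proof. by move=> x y; rewrite -iquot_mulE. Qed.
Lemma iproj1 : iproj 1 = 1. Proof. by []. Qed.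

Lemma iprojZ a : {morph iproj : x / a *: x}.
Proof. by move=> x; rewrite linearZ. Qed.

Lemma iquot_scaleAl a (x y : iquot) : a *: (x * y) = (a *: x) * y.
Proof.
by rewrite -[x]ireprK -[y]ireprK -iprojM -!iprojZ -iprojM scalerAl.
Qed.
Lemma iquot_scaleAr a (x y : iquot) : a *: (x * y) = x * (a *: y).
Proof.
by rewrite -[x]ireprK -[y]ireprK -iprojM -!iprojZ -iprojM scalerAr.
Qed.

Section IdealLift.
Context (B : algType K) (f : A -> B).
Hypotheses (fL : linear f) (fM : monoid_morphism f).
Hypothesis fR : forall r, R r -> f r = 0.

Let f0 : f 0 = 0.
Proof. by have := fL (-1) 0 0; rewrite scaler0 addr0 scaleN1r addNr. Qed.

Definition ilift (x : iquot) : B := f (irepr x).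

Let ker_ideal z : lspan ideal_gen z -> f z = 0.
Proof.
elim=> [|a _ v [b [r [c [Rr ->]]]] _ IH]; first exact: f0.
by rewrite fL IH !fM.2 (fR Rr) mulr0 mul0r scaler0 addr0.
Qed.

Lemma ilift_proj x : ilift (iproj x) = f x.
Proof.
have /lproj_eq/ker_ideal : iproj (irepr (iproj x)) = iproj x by exact: ireprK.
rewrite addrC -scaleN1r fL scaleN1r addrC => fB.
by apply/eqP; rewrite -subr_eq0; apply/eqP.
Qed.

Lemma ilift_linear : linear ilift.
Proof.
move=> a x y; rewrite -[x]ireprK -[y]ireprK -iprojZ -(linearD iproj).
by rewrite !ilift_proj fL.
Qed.

Lemma ilift_monoid : monoid_morphism ilift.
Proof.
split=> [|x y]; first by rewrite ilift_proj fM.1.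
by rewrite -[x]ireprK -[y]ireprK -iprojM !ilift_proj fM.2.
Qed.

Lemma iquot_nontrivial : 1 != 0 :> iquot.
Proof.
apply/eqP => /(congr1 ilift); rewrite -(linear0 iproj) !ilift_proj f0 fM.1.
by apply/eqP/oner_neq0.
Qed.
End IdealLift.

End IdealQuotient.

Section TensorAlgebra.
Context (K : fieldType).

(** The free associative algebra on the underlying set of [V]. *)
Definition free_alg (V : lmodType K) : Type := {malg K[{fmonom V}]}.

Section FreeAlg.
Context (V : lmodType K).
HB.instance Definition _ := GRing.Lalgebra.on (free_alg V).

Fact free_alg_scaleAr a (x y : free_alg V) : a *: (x * y) = x * (a *: y).
Proof.
have C (z : free_alg V) : z * malgC a = a *: z.
  rewrite malgM_def fgmulgU malgZ_def /fgscale; apply: eq_bigr => k _.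
  by rewrite mulm1 mulrC.
by rewrite -!C mulrA.
Qed.
HB.instance Definition _ :=
  GRing.Lalgebra_isAlgebra.Build K (free_alg V) free_alg_scaleAr.

Definition fgen (v : V) : free_alg V := << fmu v >>.

End FreeAlg.

Section FreeLift.
Context (V : lmodType K) (B : algType K) (f : V -> B).

Definition word_val (w : {fmonom V}) : B := \prod_(v <- (w : seq V)) f v.

Fact word_val_mmorphism : mmorphism word_val.
Proof.
split=> [x y|]; first by rewrite /word_val fmM big_cat.
by rewrite /word_val fm1 big_nil.
Qed.
HB.instance Definition _ :=
  isMultiplicative.Build {fmonom V} B word_val word_val_mmorphism.

Definition free_lift (x : free_alg V) : B := mmap (in_alg B) word_val x.

Fact free_lift_linear : linear free_lift.
Proof.
by move=> a x y; rewrite /free_lift raddfD /= mmapZ mulr_algl.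
Qed.
Fact free_lift_monoid : monoid_morphism free_lift.
Proof.
have C (g : free_alg V) m m' :
    GRing.comm (in_alg B g@_m) (word_val m').
  by rewrite /GRing.comm mulr_algl mulr_algr.
by have [fM f1] := commr_mmap_is_multiplicative C; split.
Qed.
HB.instance Definition _ :=
  GRing.isLinear.Build K (free_alg V) B _ free_lift free_lift_linear.
HB.instance Definition _ :=
  GRing.isMonoidMorphism.Build (free_alg V) B free_lift free_lift_monoid.

Lemma free_lift_gen v : free_lift (fgen v) = f v.
Proof.
by rewrite /free_lift mmapU /= scale1r mul1r /word_val fmU big_seq1.
Qed.
End FreeLift.
Section TAlg.
Context (V : lmodType K).

Inductive talg_rel : set (free_alg V) :=
| talg_rel_lin a u v : talg_rel (fgen (a *: u + v) - (a *: fgen u + fgen v)).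

Definition talg : Type := iquot talg_rel.
HB.instance Definition _ := GRing.Lmodule.on talg.
HB.instance Definition _ := GRing.PzRing.on talg.

(** The canonical inclusion of [V] in its tensor algebra. *)
Definition tin (v : V) : talg := iproj talg_rel (fgen v).

Lemma tin_is_linear : linear tin.
Proof.
move=> a u v; rewrite /tin -iprojZ -(linearD (iproj _)).
apply/eqP; rewrite -subr_eq0 -linearB; apply/eqP/iproj_rel.
exact: talg_rel_lin.
Qed.
HB.instance Definition _ := GRing.isLinear.Build K V talg _ tin tin_is_linear.

Section Lift.
Context (B : algType K) (f : V -> B) (fL : linear f).

Fact free_lift_rel r : talg_rel r -> free_lift f r = 0.
Proof.
case=> a u v; rewrite linearB (linearP (free_lift f)) /= !free_lift_gen fL.
exact: subrr.
Qed.

Definition talg_lift : talg -> B := ilift (free_lift f).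

Lemma talg_lift_in v : talg_lift (tin v) = f v.
Proof.
rewrite /talg_lift ilift_proj ?free_lift_gen //.
- exact: free_lift_linear.
- exact: free_lift_monoid.
- exact: free_lift_rel.
Qed.

Lemma talg_lift_linear : linear talg_lift.
Proof.
apply: ilift_linear.
- exact: free_lift_linear.
- exact: free_lift_monoid.
- exact: free_lift_rel.
Qed.

Lemma talg_lift_monoid : monoid_morphism talg_lift.
Proof.
apply: ilift_monoid.
- exact: free_lift_linear.
- exact: free_lift_monoid.
- exact: free_lift_rel.
Qed.
End Lift.

Fact talg_nontrivial : 1 != 0 :> talg.
Proof.
have L0 : linear (fun _ : V => 0 : K^o) by move=> a u v; rewrite scaler0 addr0.
apply: (@iquot_nontrivial _ _ _ _ (free_lift (fun _ : V => 0 : K^o))).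
- exact: free_lift_linear.
- exact: free_lift_monoid.
- by move=> r; apply: free_lift_rel.
Qed.
HB.instance Definition _ := GRing.PzSemiRing_isNonZero.Build talg talg_nontrivial.
HB.instance Definition _ :=
  GRing.Lmodule_isLalgebra.Build K talg (@iquot_scaleAl _ _ talg_rel).
HB.instance Definition _ :=
  GRing.Lalgebra_isAlgebra.Build K talg (@iquot_scaleAr _ _ talg_rel).

End TAlg.

End TensorAlgebra.

Record hopfAlgType (K : fieldType) := HopfAlgType {
  hopf_alg :> algType K;
  comul : {linear hopf_alg -> tensor hopf_alg hopf_alg};
  counit : {scalar hopf_alg};
  antipode : {linear hopf_alg -> hopf_alg};
  coassoc : forall h : hopf_alg,
    \sw_(h1, h2 <- comul h) \sw_(h11, h12 <- comul h1) tens h11 (tens h12 h2) =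
    \sw_(h1, h2 <- comul h) tens h1 (comul h2);
  counitl : forall h : hopf_alg, \sw_(h1, h2 <- comul h) (counit h1 *: h2) = h;
  counitr : forall h : hopf_alg, \sw_(h1, h2 <- comul h) (counit h2 *: h1) = h;
  comulM : forall h k : hopf_alg,
    comul (h * k) =
    \sw_(h1, h2 <- comul h) \sw_(k1, k2 <- comul k)
      @tens K hopf_alg hopf_alg (h1 * k1) (h2 * k2);
  comul1 : comul 1 = @tens K hopf_alg hopf_alg 1 1;
  counitM : forall h k : hopf_alg, counit (h * k) = counit h * counit k;
  counit1 : counit 1 = 1;
  antipodel : forall h : hopf_alg,
    \sw_(h1, h2 <- comul h) (antipode h1 * h2) = counit h *: 1;
  antipoder : forall h : hopf_alg,
    \sw_(h1, h2 <- comul h) (h1 * antipode h2) = counit h *: 1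
}.

Arguments comul {K _}.
Arguments counit {K _}.
Arguments antipode {K _}.

Section Pointed.
Context (K : fieldType) (H : hopfAlgType K).

Definition grouplike : set H :=
  [set g | comul g = tens g g /\ counit g = 1].

Definition is_subspace (C : set H) : Prop :=
  C 0 /\ forall (a : K) x y, C x -> C y -> C (a *: x + y).

(** [C (x) C], as a subspace of [H (x) H] *)
Definition tensor_square (C : set H) : set (tensor H H) :=
  lspan [set t | exists x y, [/\ C x, C y & t = tens x y]].

Definition subcoalgebra (C : set H) : Prop :=
  is_subspace C /\ forall c, C c -> tensor_square C (comul c).

Definition simple_subcoalgebra (C : set H) : Prop :=
  [/\ subcoalgebra C, C <> [set 0]%classic &
      forall D : set H, subcoalgebra D -> (D `<=` C)%classic -> D = [set 0]%classic \/ D = C].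

Definition one_dimensional (C : set H) : Prop :=
  exists2 c : H, c != 0 & C = [set x | exists a : K, x = a *: c]%classic.

Definition pointed : Prop :=
  forall C : set H, simple_subcoalgebra C -> one_dimensional C.

End Pointed.
Arguments grouplike {K} H.
Arguments pointed {K} H.

Section Hpar.
Context (K : fieldType) (H : hopfAlgType K).

Local Notation tin := (@tin K H).

Inductive hpar_rel : set (talg H) :=
| hpar_rel_1 : hpar_rel (tin 1 - 1)
| hpar_rel_l (h k : H) : hpar_rel
    (\sw_(k1, k2 <- comul k) (tin h * tin k1 * tin (antipode k2)) -
     \sw_(k1, k2 <- comul k) (tin (h * k1) * tin (antipode k2)))
| hpar_rel_r (h k : H) : hpar_rel
    (\sw_(h1, h2 <- comul h) (tin h1 * tin (antipode h2) * tin k) -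
     \sw_(h1, h2 <- comul h) (tin h1 * tin (antipode h2 * k))).

Definition hpar : Type := iquot hpar_rel.
HB.instance Definition _ := GRing.Lmodule.on hpar.
HB.instance Definition _ := GRing.PzRing.on hpar.

Lemma tlift_comp (U V W W' : lmodType K) (f : W -> W') (B : U -> V -> W) t :
  linear f -> f (\sw_(x, y <- t) B x y) = \sw_(x, y <- t) f (B x y).
Proof.
move=> fL; have fD u v : f (u + v) = f u + f v.
  by have := fL 1 u v; rewrite !scale1r.
have f0 : f 0 = 0 by apply: (addIr (f 0)); rewrite -fD !add0r.
rewrite /tlift (big_morph f fD f0); apply: eq_bigr => p _.
by have := fL (lrepr t)@_p (B p.1 p.2) 0; rewrite f0 !addr0.
Qed.

Lemma eq_tlift (U V W : lmodType K) (B B' : U -> V -> W) t :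
  (forall x y, B x y = B' x y) -> tlift t B = tlift t B'.
Proof. by move=> E; apply: eq_bigr => p _; rewrite E. Qed.

Fact hpar_nontrivial : 1 != 0 :> hpar.
Proof.
have L : linear (@idfun H) by [].
have [f1 fM] := talg_lift_monoid L.
have fL := talg_lift_linear L.
have fB x y : talg_lift (@idfun H) (x - y) = talg_lift idfun x - talg_lift idfun y.
  by rewrite addrC -scaleN1r fL scaleN1r addrC.
have fin h : talg_lift (@idfun H) (tin h) = h by rewrite talg_lift_in.
apply: (iquot_nontrivial fL (conj f1 fM)) => _ [|h k|h k]; rewrite fB.
- by rewrite fin f1 subrr.
- apply/eqP; rewrite subr_eq0; apply/eqP.
  etransitivity; [exact: tlift_comp|symmetry; etransitivity; [exact: tlift_comp|]].
  by apply: eq_tlift => x y; rewrite fM fin 2!fM !fin.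
- apply/eqP; rewrite subr_eq0; apply/eqP.
  etransitivity; [exact: tlift_comp|symmetry; etransitivity; [exact: tlift_comp|]].
  by apply: eq_tlift => x y; rewrite fM !fin 2!fM !fin mulrA.
Qed.
HB.instance Definition _ := GRing.PzSemiRing_isNonZero.Build hpar hpar_nontrivial.
HB.instance Definition _ :=
  GRing.Lmodule_isLalgebra.Build K hpar (@iquot_scaleAl _ _ hpar_rel).
HB.instance Definition _ :=
  GRing.Lalgebra_isAlgebra.Build K hpar (@iquot_scaleAr _ _ hpar_rel).

(** [pbr h] is the class of [h], and [peps h] is [eps_h]. *)
Definition pbr (h : H) : hpar := iproj hpar_rel (tin h).

Lemma pbr_is_linear : linear pbr.
Proof.
move=> a x y; rewrite /pbr (tin_is_linear a x y).
exact: (iproj_is_linear hpar_rel a (tin x) (tin y)).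
Qed.
HB.instance Definition _ := GRing.isLinear.Build K H hpar _ pbr pbr_is_linear.

Let hpar_eq (x y : talg H) :
  hpar_rel (x - y) -> iproj hpar_rel x = iproj hpar_rel y.
Proof.
move=> /iproj_rel xy; have := iproj_is_linear hpar_rel 1 (x - y) y.
by rewrite xy !scale1r subrK add0r.
Qed.

Let iproj_sw (B : H -> H -> talg H) t :
  iproj hpar_rel (\sw_(x, y <- t) B x y) =
  \sw_(x, y <- t) iproj hpar_rel (B x y).
Proof. exact: (tlift_comp _ _ (iproj_is_linear hpar_rel)). Qed.

Lemma pbr1 : pbr 1 = 1.
Proof. exact: hpar_eq hpar_rel_1. Qed.

Lemma pbr_mull h k :
  \sw_(k1, k2 <- comul k) (pbr h * pbr k1 * pbr (antipode k2)) =
  \sw_(k1, k2 <- comul k) (pbr (h * k1) * pbr (antipode k2)).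
Proof.
have := hpar_eq (hpar_rel_l h k); rewrite 2!iproj_sw => E.
etransitivity; first (etransitivity; last exact: E).
  by apply: eq_tlift => x y; rewrite !iprojM.
by apply: eq_tlift => x y; rewrite !iprojM.
Qed.

Lemma pbr_mulr h k :
  \sw_(h1, h2 <- comul h) (pbr h1 * pbr (antipode h2) * pbr k) =
  \sw_(h1, h2 <- comul h) (pbr h1 * pbr (antipode h2 * k)).
Proof.
have := hpar_eq (hpar_rel_r h k); rewrite 2!iproj_sw => E.
etransitivity; first (etransitivity; last exact: E).
  by apply: eq_tlift => x y; rewrite !iprojM.
by apply: eq_tlift => x y; rewrite !iprojM.
Qed.

Definition peps (h : H) : hpar :=
  \sw_(h1, h2 <- comul h) (pbr h1 * pbr (antipode h2)).

(** [fset_set] is the empty set on infinite sets: the definitions below are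
    meaningful when [H] has finitely many grouplike elements. *)
Definition glset : {fset H} := fset_set (grouplike H).

Definition P1 : {fset {fset H}} := [fset X in fpowerset glset | 1 \in X]%fset.

(** The factors of [PX] commute pairwise, so that the order in which
    the finite sets are enumerated is immaterial. *)
Definition PX (X : {fset H}) : hpar :=
  (\prod_(x <- X) peps x) * \prod_(y <- (glset `\` X)%fset) (1 - peps y).

(** [X ~ Y]; here [g'] is the inverse of [g] *)
Definition peq (X Y : {fset H}) : Prop :=
  exists2 g : H, g \in glset &
    (exists2 g' : H, g * g' = 1 /\ g' * g = 1 & g' \in X) /\
    [fset g * x | x in X]%fset = Y.

Definition Gamma (X : {fset H}) : hpar := \sum_(Y <- P1 | `[< peq Y X >]) PX Y.

Definition complete_representatives (n : nat) (X : 'I_n -> {fset H}) : Prop :=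
  [/\ forall k, X k \in P1,
      forall Y, Y \in P1 -> exists k, peq Y (X k) &
      forall k l, peq (X k) (X l) -> k = l].

End Hpar.
Arguments hpar {K} H.

Definition left_principal (A : nzRingType) (z : A) : set A :=
  [set x | exists a, x = a * z].

Definition two_sided_ideal (A : nzRingType) (I : set A) : Prop :=
  [/\ I 0, forall x y, I x -> I y -> I (x + y),
      forall a x, I x -> I (a * x) & forall a x, I x -> I (x * a)].

Definition direct_sum (V : zmodType) (n : nat) (W : 'I_n -> set V) : Prop :=
  forall v : V, exists! w : {ffun 'I_n -> V},
    (forall k, W k (w k)) /\ v = \sum_(k < n) w k.

(* Main.v *)
From HB Require Import structures.
Require Import Defs.
From mathcomp Require Import all_boot all_order all_algebra.
From mathcomp Require Import finmap.
From mathcomp Require Import boolp classical_sets functions cardinality.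
From mathcomp.multinomials Require Import monalg.

(** The blocks [H_par Gamma_X] decompose [H_par] because the elements [Gamma_X] are
    orthogonal central idempotents with sum 1.

    The [eps_g] with [g] grouplike are commuting idempotents, so the [P_X] are the
    atoms of the Boolean algebra that they generate: orthogonal idempotents with
    sum 1, where only the [X] that contain 1 count because [eps_1 = 1]
    ([PX_orth], [sum_PX]). Since each [Gamma_X] is the sum of the [P_Y] over one
    equivalence class, only centrality is at stake, and it reduces to the vanishing
    of [P_Y [h] P_X] for all [h] in [H] when [X] and [Y] are not equivalent
    ([PX_pbr_PX_eq0]).

    For this, two commutation rules are used: [[h] eps_t = eps_(h_1 t) [h_2]] for
    [t] grouplike ([pbr_peps_gl]), and the fact that [eps_t] commutes with [eps_k]
    for every [k] in [H] ([peps_gl_comm]). Suppose that [P_Y [h] P_X] is nonzero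
    for some [h], and let [W] be the largest left coideal on which
    [h |-> P_Y [h] P_X] vanishes. The left comodule [H / W] is nonzero, and [H] is
    pointed, so [H / W] contains a one-dimensional subcomodule
    ([pointed_semi_invariant]): there are [k] outside [W] and a grouplike [b] such
    that [Delta k = b (x) k] modulo [H (x) W]. The first rule then reads
    [P_Y [k] P_X eps_t = eps_(bt) P_Y [k] P_X], the terms in [H (x) W] being killed
    thanks to the second rule. Comparing eigenvalues, [t] is in [X] if and only if
    [bt] is in [Y], so [Y = bX] and [X ~ Y].

    The existence of the one-dimensional subcomodule is proved inside [H], with
    linear forms acting by [f(h_1) h_2] and [f(h_2) h_1]: a simple comodule has a
    coefficient coalgebra that is a sum of copies of it as a comodule, and a
    grouplike in this sum forces the simple comodule to be one-dimensional. *)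

Set Implicit Arguments.
Unset Strict Implicit.
Unset Printing Implicit Defensive.

Import GRing.Theory.
Local Open Scope fset_scope.
Local Open Scope ring_scope.

(** * Subspaces and linear forms of an arbitrary vector space *)

Section Subspaces.
Context (K : fieldType) (V : lmodType K).
Implicit Types (S T : set V) (s : seq V).

(** On a Hopf algebra this is convertible to [is_subspace]. *)
Definition subspace S : Prop :=
  S 0 /\ forall (a : K) x y, S x -> S y -> S (a *: x + y).

Lemma subspace_lspan S : subspace (lspan S).
Proof.
by split=> [|a x y Sx Sy]; [apply: lspan0 | apply: lspanD => //; apply: lspanZ].
Qed.

Lemma lspan_sub S T : subspace T -> (S `<=` T)%classic -> (lspan S `<=` T)%classic.
Proof. by move=> [T0 TD] ST x; elim=> // a u v /ST Tu _; apply: TD. Qed.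

Lemma lspan_mono S T : (S `<=` T)%classic -> (lspan S `<=` lspan T)%classic.
Proof.
by move=> ST; apply: lspan_sub (subspace_lspan T) _ => x /ST; apply: lspanS.
Qed.

Section Closure.
Context (S : set V) (SS : subspace S).
Lemma subspace0 : S 0. Proof. by case: SS. Qed.
Lemma subspaceZ a x : S x -> S (a *: x).
Proof. by case: SS => S0 SD Sx; rewrite -[_ *: _]addr0; apply: SD. Qed.
Lemma subspaceD x y : S x -> S y -> S (x + y).
Proof. by case: SS => S0 SD Sx; rewrite -[x]scale1r; apply: SD. Qed.
Lemma subspaceN x : S x -> S (- x).
Proof. by rewrite -scaleN1r; apply: subspaceZ. Qed.
Lemma subspaceB x y : S x -> S y -> S (x - y).
Proof. by move=> Sx /subspaceN; apply: subspaceD. Qed.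
Lemma subspace_sum (I : Type) (r : seq I) (P : pred I) (F : I -> V) :
  (forall i, P i -> S (F i)) -> S (\sum_(i <- r | P i) F i).
Proof.
by move=> SF; elim/big_ind: _ => //; [apply: subspace0 | apply: subspaceD].
Qed.
End Closure.

(** By Zorn's lemma there is a subspace [M] that contains [S] and is maximal
    among those avoiding [x]. Maximality makes [M] a hyperplane with complement
    the line of [x], and the form is the coordinate along this line. *)
Lemma separating_form S x :
  subspace S -> ~ S x ->
  exists f : {scalar V}, f x = 1 /\ forall y, S y -> f y = 0.
Proof.
move=> SS Sx.
pose P (A : set V) := subspace (A `|` S)%classic /\ ~ (A `|` S)%classic x.
have [F FP Ftot|A [[AS Ax] Amax]] := @Zorn_bigcup V P.
  split; last by case=> [[B FB Bx]|//]; have [_] := FP _ FB; apply; left.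
  split=> [|a u v]; first by right; case: SS.
  have mem B w : F B -> (B `|` S)%classic w -> (\bigcup_(X in F) X `|` S)%classic w.
    by move=> FB [Bw|]; [left; exists B | right].
  case=> [[B FB Bu]|Su]; case=> [[C FC Cv]|Sv].
  - have [D FD [Du Dv]] : exists2 D, F D & D u /\ D v.
      by have [BC|CB] := Ftot _ _ FB FC; [exists C|exists B] => //; split=> //;
        [apply: BC | apply: CB].
    by apply: (mem D) => //; have [[_ DD] _] := FP _ FD; apply: DD; left.
  - by apply: (mem B) => //; have [[_ DD] _] := FP _ FB; apply: DD; [left|right].
  - by apply: (mem C) => //; have [[_ DD] _] := FP _ FC; apply: DD; [right|left].
  - by right; case: SS => _; apply.
set M := (A `|` S)%classic in AS Ax.
(* Otherwise adjoining [v] to [M] would give a larger subspace avoiding [x]. *)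
have decomp v : exists c, M (v - c *: x).
  apply: contrapT => Nv.
  pose B : set V := [set w | exists c, M (w - c *: v)]%classic.
  have MB : (M `<=` B)%classic by move=> w Mw; exists 0; rewrite scale0r subr0.
  have BS : (B `|` S = B)%classic.
    by apply/seteqP; split=> [w [//|Sw]|w]; [apply: MB; right | left].
  apply: (Amax B).
    rewrite properEneq; split; last by move=> w Aw; apply: MB; left.
    apply/eqP => AB; have : A v by rewrite AB; exists 1; rewrite scale1r subrr;
      apply: (subspace0 AS).
    by move=> Av; apply: Nv; exists 0; rewrite scale0r subr0; left.
  rewrite /P BS; split.
    split=> [|a u w [c Mu] [d Mw]]; first by apply: MB; apply: subspace0.
    exists (a * c + d); rewrite scalerDl -scalerA opprD addrACA -scalerBr.
    by apply: AS.2.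
  move=> [c Mx]; have [c0|c0] := eqVneq c 0.
    by apply: Ax; move: Mx; rewrite c0 scale0r subr0.
  apply: Nv; exists c^-1; have := subspaceZ AS (- c^-1) Mx.
  by rewrite scalerBr scalerA mulNr mulVf // scaleN1r opprK addrC scaleNr.
have uniq v c d : M (v - c *: x) -> M (v - d *: x) -> c = d.
  move=> Mc Md; apply/eqP; rewrite -subr_eq0; apply: contrapT => /negP cd.
  apply: Ax; have := subspaceZ AS (c - d)^-1 (subspaceB AS Md Mc).
  have -> : v - d *: x - (v - c *: x) = (c - d) *: x.
    by rewrite opprB addrC addrA subrK scalerBl.
  by rewrite scalerA mulVf // scale1r.
pose f v : K := projT1 (cid (decomp v)).
have fP v : M (v - f v *: x) by rewrite /f; case: cid.
have fL : scalar f.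
  move=> a u v; apply: (uniq (a *: u + v)); first exact: fP.
  by rewrite scalerDl -scalerA opprD addrACA -scalerBr; apply: AS.2.
pose F : {scalar V} := HB.pack f (GRing.isLinear.Build K V K *%R f fL).
exists F; split=> [|y Sy]; rewrite /F /=.
  by apply: (uniq x); [apply: fP | rewrite scale1r subrr; apply: subspace0].
by apply: (uniq y); [apply: fP | rewrite scale0r subr0; right].
Qed.

Lemma forms_separate_points x : (forall f : {scalar V}, f x = 0) -> x = 0.
Proof.
move=> fx; apply: contrapT => x0.
have S0 : subspace [set 0 : V]%classic.
  by split=> // a u v -> ->; rewrite scaler0 addr0.
have [f [f1 _]] := separating_form S0 x0.
by have := oner_neq0 K; rewrite -f1 fx eqxx.
Qed.

Definition fin_dim S : Prop := exists s, (S `<=` lspan [set` s])%classic.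

(** The exchange step of Steinitz: a form that vanishes on [T] but not on the
    span of [s] is nonzero at some entry [z] of [s], and the projection along [z]
    onto its kernel fixes [T] and kills [z]. This measures dimension by lengths
    of spanning lists. *)
Lemma lspan_exchange (f : {scalar V}) s x T :
  (T `<=` lspan [set` s])%classic -> (forall y, T y -> f y = 0) ->
  lspan [set` s] x -> f x != 0 ->
  exists2 s', (size s' < size s)%N & (T `<=` lspan [set` s'])%classic.
Proof.
move=> Ts T0 sx fx.
have [z zs fz] : exists2 z, z \in s & f z != 0.
  apply: contrapT => Nz; move/eqP: fx; apply; elim: sx => [|a u v us _ IH].
    exact: raddf0.
  rewrite linearP IH addr0; have -> : f u = 0; last by rewrite mulr0.
  by apply/eqP/negPn/negP => fu; apply: Nz; exists u.
pose p y := y - (f y / f z) *: z.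
exists [seq p y | y <- rem z s].
  by rewrite size_map size_rem // prednK //; case: (s) zs.
have pS y : lspan [set` s] y -> lspan [set` [seq p y | y <- rem z s]] (p y).
  elim=> [|a u v us _ IH].
    by rewrite /p raddf0 mul0r scale0r subr0; apply: lspan0.
  have -> : p (a *: u + v) = a *: p u + p v.
    rewrite /p linearP mulrDl scalerDl scalerBr opprD addrACA scalerA.
    by rewrite mulrA.
  apply: (subspace_lspan _).2 => //.
  have [->|uz] := eqVneq u z; first by rewrite /p divff // scale1r subrr; apply: lspan0.
  apply: lspanS; apply/mapP; exists u => //.
  move: (us : u \in s); rewrite (perm_mem (perm_to_rem zs)) inE.
  by rewrite (negPf uz).
move=> y Ty; have := pS y (Ts y Ty).
by rewrite {2}/p (T0 y Ty) mul0r scale0r subr0.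
Qed.

(** A smaller subspace of the family is separated from the larger one by a form,
    hence has a shorter spanning list, so that the descent stops. *)
Lemma exists_minimal (P : set V -> Prop) S :
  (forall T, P T -> subspace T) -> P S -> fin_dim S ->
  exists N, [/\ P N, (N `<=` S)%classic &
                forall T, P T -> (T `<=` N)%classic -> (N `<=` T)%classic].
Proof.
move=> PS + [s]; elim: {s}_.+1 {-2}s (ltnSn (size s)) S => // n IH s ns S PS0 Ss.
have [[T [PT [TS NST]]]|minS] :=
    pselect (exists T, P T /\ (T `<=` S)%classic /\ ~ (S `<=` T)%classic); last first.
  exists S; split=> // T PT TS; apply: contrapT => NST.
  by apply: minS; exists T.
have [x [Sx Tx]] : exists x, S x /\ ~ T x.
  apply: contrapT => Nx; apply: NST => x Sx; apply: contrapT => Tx.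
  by apply: Nx; exists x.
have [f [fx fT]] := separating_form (PS _ PT) Tx.
have [||s' s's Ts'] := @lspan_exchange f s x T _ fT (Ss _ Sx).
- exact: subset_trans TS Ss.
- by rewrite fx oner_neq0.
have [N [PN NT minN]] := IH s' (leq_trans s's ns) T PT Ts'.
by exists N; split=> //; apply: subset_trans NT TS.
Qed.

End Subspaces.

(** * Tensors and their slices *)

Section Tensors.
Context (K : fieldType).
Implicit Types U V W : lmodType K.

Definition bilin U V W (B : U -> V -> W) : Prop :=
  (forall v, linear (B^~ v)) /\ (forall u, linear (B u)).

(* Versions for bare functions: the hypotheses of [tlift_tens] speak of functions
   that carry no linear structure. *)
Lemma linear_0 V W (f : V -> W) : linear f -> f 0 = 0.
Proof. by move=> fL; have := fL (-1) 0 0; rewrite scaler0 addr0 scaleN1r addNr. Qed.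
Lemma linear_D V W (f : V -> W) x y : linear f -> f (x + y) = f x + f y.
Proof. by move=> fL; have := fL 1 x y; rewrite !scale1r. Qed.
Lemma linear_B V W (f : V -> W) x y : linear f -> f (x - y) = f x - f y.
Proof. by move=> fL; rewrite addrC -scaleN1r fL scaleN1r addrC. Qed.
Lemma linear_Z V W (f : V -> W) a x : linear f -> f (a *: x) = a *: f x.
Proof. by move=> fL; have := fL a x 0; rewrite (linear_0 fL) !addr0. Qed.

Lemma tlift_pure U V W (B : U -> V -> W) u v : bilin B -> tlift (tens u v) B = B u v.
Proof. by case=> *; apply: tlift_tens. Qed.
Lemma tlift_lin U V W (B : U -> V -> W) : bilin B -> linear (fun t => tlift t B).
Proof. by case=> *; apply: tlift_linear. Qed.

Lemma linear_sw U V W W' (B : W' -> U -> V -> W) t :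
  (forall u v, linear (fun x => B x u v)) -> linear (fun x => tlift t (B x)).
Proof.
move=> BL a x y; rewrite /tlift scaler_sumr -big_split /=; apply: eq_bigr => p _.
by rewrite BL scalerDr !scalerA mulrC.
Qed.

Lemma tens_bilin U V : bilin (@tens K U V).
Proof.
split=> [v a x y|u a x y]; rewrite /tens -linearP; apply/lproj_eq/lspanS.
  exact: tensor_rel_l.
exact: tensor_rel_r.
Qed.

Lemma tensP U V (t : tensor U V) :
  exists s : seq (U * V), t = \sum_(p <- s) tens p.1 p.2.
Proof.
pose m : {malg K[(U * V)%type]} := lrepr t.
exists [seq (m@_p *: p.1, p.2) | p <- msupp m].
rewrite -[LHS]lreprK -/m {1}(monalgE m) raddf_sum big_map.
apply: eq_bigr => p _ /=; rewrite (linear_Z _ _ ((tens_bilin U V).1 p.2)).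
rewrite /tens -linearZ; congr lproj; case: p => u v.
by apply/malgP => q; rewrite mcoeffZ !mcoeffU mulrnAr mulr1.
Qed.

Lemma tlift_tens_sum U V W (B : U -> V -> W) (s : seq (U * V)) : bilin B ->
  tlift (\sum_(p <- s) tens p.1 p.2) B = \sum_(p <- s) B p.1 p.2.
Proof.
move=> BB; have BL := tlift_lin BB.
elim: s => [|p s IH]; first by rewrite !big_nil; apply: (linear_0 BL).
by rewrite !big_cons (linear_D _ _ BL) IH tlift_pure.
Qed.

Lemma tlift_tensK U V (t : tensor U V) : tlift t (@tens K U V) = t.
Proof.
have [s ->] := tensP t; apply: tlift_tens_sum; exact: tens_bilin.
Qed.

Lemma linear_bilin U V W W' (f : W -> W') (B : U -> V -> W) :
  linear f -> bilin B -> bilin (fun u v => f (B u v)).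
Proof.
by move=> fL [Bl Br]; split=> [v a x y|u a x y] /=; rewrite ?(Bl v) ?(Br u) fL.
Qed.

Lemma bilin_comp U V U' V' W (f : U' -> U) (g : V' -> V) (B : U -> V -> W) :
  linear f -> linear g -> bilin B -> bilin (fun u v => B (f u) (g v)).
Proof.
move=> fL gL [Bl Br]; split=> [v a x y|u a x y] /=.
  by rewrite fL (Bl (g v)).
by rewrite gL (Br (f u)).
Qed.

Lemma mul_bilin (A : algType K) : bilin (fun x y : A => x * y).
Proof.
split=> [v a x y|u a x y] /=; first by rewrite mulrDl scalerAl.
by rewrite mulrDr scalerAr.
Qed.

Lemma scale_bilin V (f : {scalar V}) W : bilin (fun (x : V) (y : W) => f x *: y).
Proof.
split=> [v a x y|u a x y] /=; first by rewrite linearP scalerDl scalerA.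
by rewrite scalerDr !scalerA mulrC.
Qed.

Lemma scale_bilinr V (f : {scalar V}) W : bilin (fun (x : W) (y : V) => f y *: x).
Proof. by have [? ?] := scale_bilin f W; split. Qed.

Definition slicel U V (f : {scalar U}) (t : tensor U V) : V :=
  \sw_(x, y <- t) (f x *: y).
Definition slicer U V (g : {scalar V}) (t : tensor U V) : U :=
  \sw_(x, y <- t) (g y *: x).

Definition tprod U V (S : set U) (T : set V) : set (tensor U V) :=
  lspan [set t | exists x y, [/\ S x, T y & t = tens x y]]%classic.

(** If [y] depends linearly on the second components of a sum of pure tensors,
    then [x (x) y] is absorbed by changing the first components only. *)
Lemma tens_absorb_dependent U V (s : seq (U * V)) (x : U) (y : V) :
  lspan [set` [seq p.2 | p <- s]] y ->
  exists s' : seq (U * V), [seq p.2 | p <- s'] = [seq p.2 | p <- s] /\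
    tens x y + \sum_(p <- s) tens p.1 p.2 = \sum_(p <- s') tens p.1 p.2.
Proof.
move=> sy; suff: forall r : seq (U * V), [seq p.2 | p <- r] = [seq p.2 | p <- s] ->
    exists s' : seq (U * V), [seq p.2 | p <- s'] = [seq p.2 | p <- s] /\
      tens x y + \sum_(p <- r) tens p.1 p.2 = \sum_(p <- s') tens p.1 p.2.
  exact.
elim: sy x => [|a y1 y' sy1 _ IH] x r er.
  by exists r; rewrite (linear_0 ((tens_bilin U V).2 x)) add0r.
have [r1 [er1 tr1]] := IH x r er.
rewrite ((tens_bilin U V).2 x) -addrA tr1.
have {}sy1 : y1 \in [seq p.2 | p <- r1] by rewrite er1.
rewrite -er1; elim: {er1 tr1} r1 sy1 => //= q r1 IH1.
rewrite inE => /orP[/eqP ->|/IH1[r2 [er2 tr2]]].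
  exists ((a *: x + q.1, q.2) :: r1); split=> //.
  by rewrite !big_cons ((tens_bilin U V).1) /= addrA.
exists (q :: r2); rewrite /= er2; split=> //.
by rewrite !big_cons addrCA tr2.
Qed.

(** Induction on the number of pure tensors that are not known to lie in
    [S (x) T]. When the second component of the first of them depends on the
    others, it is absorbed by them. Otherwise some form is 1 on it and 0 on the
    others; slicing by this form shows that the first component is in [S]. *)
Lemma tprod_sum_slicer U V (S : set U) (T : set V) (s : seq (U * V)) (t : tensor U V) :
  subspace S -> subspace T -> (forall p, p \in s -> T p.2) -> tprod S T t ->
  (forall g, S (slicer g (\sum_(p <- s) tens p.1 p.2 + t))) ->
  tprod S T (\sum_(p <- s) tens p.1 p.2 + t).
Proof.
move=> SS ST; elim: {s}(size s) {-2}s (erefl (size s)) t => [|n IH] [|p s] //=.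
  by move=> _ t _ St _; rewrite big_nil add0r.
move=> [ns] t sT St; rewrite big_cons.
have [sp|sp] := pselect (lspan [set` [seq p.2 | p <- s]] p.2).
  have [s' [es' ->]] := tens_absorb_dependent p.1 sp; apply: IH => //.
    by rewrite -(size_map snd s') es' size_map.
  move=> q /(map_f snd); rewrite es' => /mapP[r rs ->].
  by apply: sT; rewrite inE rs orbT.
have [g [gp gs]] := separating_form (subspace_lspan _) sp.
move=> slS.
have Sp : S p.1.
  have := slS g; rewrite /slicer; have gL := tlift_lin (scale_bilinr g U).
  rewrite !(linear_D _ _ gL) tlift_tens_sum; last exact: scale_bilinr.
  rewrite tlift_pure; last exact: scale_bilinr.
  rewrite gp scale1r big_seq big1 ?addr0 => [Sg|q qs]; last first.
    by rewrite gs ?scale0r //; apply/lspanS/map_f.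
  suff St' : S (slicer g t) by have := subspaceB SS Sg St'; rewrite addrK.
  rewrite /slicer; elim: St {Sg slS} => [|a x y [u [v [Su Tv ->]]] _ Sy].
    by rewrite (linear_0 gL); apply: subspace0.
  rewrite gL; apply: SS.2 => //; rewrite tlift_pure; last exact: scale_bilinr.
  exact: subspaceZ.
rewrite addrAC addrC; apply: IH => //.
- by move=> q qs; apply: sT; rewrite inE qs orbT.
- rewrite -[tens _ _]scale1r; apply: lspanZD => //; exists p.1, p.2; split=> //.
  by apply: sT; rewrite inE eqxx.
- by move=> g'; have := slS g'; rewrite addrAC [X in slicer _ X]addrC.
Qed.

Definition tflip U V (t : tensor U V) : tensor V U := \sw_(x, y <- t) tens y x.

Lemma tflip_bilin U V : bilin (fun (x : U) (y : V) => tens y x).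
Proof. by have [? ?] := tens_bilin V U; split. Qed.

Lemma tflipK U V (t : tensor U V) : tflip (tflip t) = t.
Proof.
have [s ->] := tensP t; rewrite /tflip.
rewrite (tlift_tens_sum s (tflip_bilin U V)).
have := @tlift_tens_sum _ _ _ _ [seq (p.2, p.1) | p <- s] (tflip_bilin V U).
by rewrite !big_map.
Qed.

Lemma slicer_flip U V (g : {scalar U}) (t : tensor U V) :
  slicer g (tflip t) = slicel g t.
Proof.
have [s ->] := tensP t; rewrite /tflip /slicer /slicel.
rewrite (tlift_tens_sum s (tflip_bilin U V)) (tlift_tens_sum s (scale_bilin g V)).
have := @tlift_tens_sum _ _ _ _ [seq (p.2, p.1) | p <- s] (scale_bilinr g V).
by rewrite !big_map.
Qed.

Lemma tprod_flip U V (S : set U) (T : set V) t :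
  tprod S T t -> tprod T S (tflip t).
Proof.
have fL := tlift_lin (tflip_bilin U V).
elim=> [|a x y [u [v [Su Tv ->]]] _ Sy].
  by rewrite /tflip (linear_0 fL); apply: lspan0.
rewrite /tflip fL; apply: lspanZD => //; exists v, u; split=> //.
rewrite tlift_pure //; exact: tflip_bilin.
Qed.

(** Slices detect [S (x) T]: the left slices first give second components in [T]
    (through the flip), then the right slices give first components in [S]. *)
Lemma tprod_slices U V (S : set U) (T : set V) (t : tensor U V) :
  subspace S -> subspace T -> (forall f, T (slicel f t)) ->
  (forall g, S (slicer g t)) -> tprod S T t.
Proof.
move=> SS ST tT tS.
have US : subspace (@setT U) by [].
have UT : tprod setT T t.
  rewrite -[t]tflipK; apply: tprod_flip; have [s ts] := tensP (tflip t).
  rewrite ts -[X in tprod _ _ X]addr0; apply: tprod_sum_slicer => //.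
    exact: lspan0.
  by move=> g; rewrite addr0 -ts slicer_flip.
have [s [sT ts]] : exists s : seq (U * V), (forall p, p \in s -> T p.2) /\
    t = \sum_(p <- s) tens p.1 p.2.
  elim: UT => [|a x y [u [v [_ Tv ->]]] _ [s [sT ->]]].
    by exists [::]; rewrite big_nil.
  exists ((a *: u, v) :: s); rewrite big_cons (linear_Z _ _ ((tens_bilin U V).1 v)).
  by split=> // p; rewrite inE => /orP[/eqP ->|/sT].
rewrite ts -[X in tprod _ _ X]addr0; apply: tprod_sum_slicer => //.
  exact: lspan0.
by move=> g; rewrite addr0 -ts.
Qed.

(** The form in which membership in [U (x) T] is used: [B] factors through
    [U (x) V/T]. *)
Lemma tlift_slicel_eq0 U V W (B : U -> V -> W) (T : set V) (t : tensor U V) :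
  bilin B -> subspace T -> (forall f, T (slicel f t)) ->
  (forall u v, T v -> B u v = 0) -> tlift t B = 0.
Proof.
move=> BB ST tT BT; have BL := tlift_lin BB.
elim: (tprod_slices (S := setT) _ ST tT) => // [|a x y [u [v [_ Tv ->]]] _ t0].
  exact: (linear_0 BL).
by rewrite BL t0 tlift_pure // BT // scaler0 addr0.
Qed.

End Tensors.

(** * The action of linear forms on a Hopf algebra *)

Section Coalgebra.
Context (K : fieldType) (H : hopfAlgType K).
Implicit Types (f g : {scalar H}) (h : H) (W : lmodType K).

Lemma coassoc_sw W (T : H -> H -> H -> W) h :
  (forall y z, linear (fun x => T x y z)) -> (forall x, bilin (T x)) ->
  \sw_(x, y <- comul h) \sw_(x1, x2 <- comul x) T x1 x2 y =
  \sw_(x, y <- comul h) \sw_(y1, y2 <- comul y) T x y1 y2.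
Proof.
move=> Tl Tr; pose F t : W := \sw_(x, y <- t) tlift y (T x).
have BF : bilin (fun (x : H) (y : tensor H H) => tlift y (T x)).
  split=> [y|x]; first by apply: linear_sw => u v; apply: Tl.
  exact: tlift_lin.
have FL : linear F by apply: tlift_lin.
have E := congr1 F (coassoc h).
have LHS : F (\sw_(x, y <- comul h) \sw_(x1, x2 <- comul x) tens x1 (tens x2 y)) =
    \sw_(x, y <- comul h) \sw_(x1, x2 <- comul x) T x1 x2 y.
  etransitivity; first exact: (tlift_comp _ _ FL).
  apply: eq_tlift => x y; etransitivity; first exact: (tlift_comp _ _ FL).
  by apply: eq_tlift => x1 x2; rewrite /F tlift_pure // tlift_pure.
rewrite -LHS E; etransitivity; first exact: (tlift_comp _ _ FL).
by apply: eq_tlift => x y; rewrite /F tlift_pure.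
Qed.

(** The two commuting actions of the dual algebra, [f(h_1) h_2] and [f(h_2) h_1].
    Left coideals, right coideals and subcoalgebras become the subspaces stable
    under one or both of them, which replaces comodules by plain linear algebra. *)
Definition lact f h : H := slicel f (comul h).
Definition ract f h : H := slicer f (comul h).

Lemma lact_linear f : linear (lact f).
Proof.
move=> a x y; rewrite /lact /slicel linearP.
exact: (tlift_lin (scale_bilin f H)).
Qed.
Lemma ract_linear f : linear (ract f).
Proof.
move=> a x y; rewrite /ract /slicer linearP.
exact: (tlift_lin (scale_bilinr f H)).
Qed.
HB.instance Definition _ f := GRing.isLinear.Build K H H _ (lact f) (lact_linear f).
HB.instance Definition _ f := GRing.isLinear.Build K H H _ (ract f) (ract_linear f).

Lemma lact_counit h : lact counit h = h. Proof. exact: counitl. Qed.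
Lemma linear_form f : linear (f : H -> K^o).
Proof. by move=> a x y; rewrite linearP. Qed.

Lemma linear_scale W (a : K) : linear (fun x : W => a *: x).
Proof. by move=> b u v; rewrite scalerDr !scalerA mulrC. Qed.
Lemma linear_scale_to W (y : W) : linear (fun a : K^o => a *: y).
Proof. by move=> a b c; rewrite scalerDl -scalerA. Qed.

Lemma form_lact f g h : f (lact g h) = g (ract f h).
Proof.
transitivity (\sw_(x, y <- comul h) (f (g x *: y) : K^o)).
  exact: (tlift_comp _ _ (linear_form f)).
symmetry; etransitivity; first exact: (tlift_comp _ _ (linear_form g)).
by apply: (@eq_tlift _ _ _ K^o) => x y; rewrite !linearZ /= mulrC.
Qed.

Lemma scale_trilin f g :
  (forall y z, linear (fun x : H => f x *: (g y *: (z : H)))) /\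
  (forall x : H, bilin (fun y z : H => f x *: (g y *: z))).
Proof.
split=> [y z|x]; first exact: (scale_bilin f H).1.
by apply: linear_bilin (scale_bilin g H); apply: (scale_bilin f H).2.
Qed.

(** [g \o ract f] is the convolution product of [g] and [f]. *)
Lemma lact_lact f g h : lact f (lact g h) = lact (g \o ract f) h.
Proof.
transitivity (\sw_(x, y <- comul h) \sw_(y1, y2 <- comul y) (g x *: (f y1 *: y2))).
  etransitivity; first exact: (tlift_comp _ _ (lact_linear f)).
  apply: eq_tlift => x y; rewrite linearZ /=.
  exact: (tlift_comp _ _ (@linear_scale H (g x))).
have [Tl Tr] := scale_trilin g f; rewrite -coassoc_sw //.
apply: eq_tlift => x y /=; symmetry; rewrite /ract /slicer.
transitivity ((\sw_(u, v <- comul x) (g (f v *: u) : K^o)) *: y).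
  congr (_ *: _); exact: (tlift_comp _ _ (linear_form g)).
etransitivity; first exact: (tlift_comp _ _ (linear_scale_to y)).
by apply: eq_tlift => u v; rewrite linearZ /= scalerA mulrC.
Qed.

Lemma lact_ract f g h : lact f (ract g h) = ract g (lact f h).
Proof.
transitivity (\sw_(x, y <- comul h) \sw_(x1, x2 <- comul x) (f x1 *: (g y *: x2))).
  etransitivity; first exact: (tlift_comp _ _ (lact_linear f)).
  apply: eq_tlift => x y; rewrite linearZ /=.
  etransitivity; first exact: (tlift_comp _ _ (@linear_scale H (g y))).
  by apply: eq_tlift => u v; rewrite !scalerA mulrC.
rewrite coassoc_sw.
- symmetry; etransitivity; first exact: (tlift_comp _ _ (ract_linear g)).
  apply: eq_tlift => x y; rewrite linearZ /=.
  exact: (tlift_comp _ _ (@linear_scale H (f x))).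
- by move=> y z; apply: (scale_bilin f H).1.
- move=> x; apply: linear_bilin (scale_bilinr g H); exact: (scale_bilin f H).2.
Qed.

(** Checked against every form [e]: by [form_lact], [e] turns right actions by
    forms into left actions by [e], and both sides become
    [g(f . (e . h))]. *)
Lemma ract_ract f g h : ract f (ract g h) = ract (g \o lact f) h.
Proof.
apply/eqP; rewrite -subr_eq0; apply/eqP/forms_separate_points => e.
rewrite linearB /= -(form_lact f e) lact_ract -(form_lact g f).
by rewrite -(form_lact (g \o lact f) e) /= subrr.
Qed.

Lemma fin_dim_lact_orbit h : fin_dim [set lact f h | f in [set: {scalar H}]]%classic.
Proof.
have [s hs] := tensP (comul h); exists [seq p.2 | p <- s].
move=> _ [f _ <-]; rewrite /lact hs /slicel tlift_tens_sum; last exact: scale_bilin.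
rewrite big_seq; apply: (subspace_sum (subspace_lspan _)) => p ps.
by apply/lspanZ/lspanS/map_f.
Qed.

Lemma fin_dim_ract h : fin_dim [set ract f h | f in [set: {scalar H}]]%classic.
Proof.
have [s hs] := tensP (comul h); exists [seq p.1 | p <- s].
move=> _ [f _ <-]; rewrite /ract hs /slicer tlift_tens_sum; last exact: scale_bilinr.
rewrite big_seq; apply: (subspace_sum (subspace_lspan _)) => p ps.
by apply/lspanZ/lspanS/map_f.
Qed.

Definition lstable (N : set H) := forall f h, N h -> N (lact f h).
Definition rstable (N : set H) := forall f h, N h -> N (ract f h).

Lemma subcoalgebraP (C : set H) :
  subcoalgebra C <-> [/\ subspace C, lstable C & rstable C].
Proof.
split=> [[CS CC]|[CS Cl Cr]]; last first.
  split=> // c Cc; apply: tprod_slices => // f; [exact: Cl | exact: Cr].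
split=> // f h /CC; rewrite /lact /ract.
  have fL := tlift_lin (scale_bilin f H).
  elim=> [|a _ y [u [v [Cu Cv ->]]] _ Cy]; rewrite /slicel.
    by rewrite (linear_0 fL); apply: subspace0.
  rewrite fL; apply: CS.2 => //; rewrite tlift_pure; last exact: scale_bilin.
  exact: subspaceZ.
have fL := tlift_lin (scale_bilinr f H).
elim=> [|a _ y [u [v [Cu Cv ->]]] _ Cy]; rewrite /slicer.
  by rewrite (linear_0 fL); apply: subspace0.
rewrite fL; apply: CS.2 => //; rewrite tlift_pure; last exact: scale_bilinr.
exact: subspaceZ.
Qed.

(** A generator [c] satisfies [Delta c = a c (x) c] for a scalar [a], and the counit
    forces [a eps(c) = 1]; so [a c] is grouplike. *)
Lemma one_dim_grouplike (C : set H) :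
  subcoalgebra C -> one_dimensional C -> exists2 b, C b & grouplike H b.
Proof.
move=> [_ CC] [c c0 Cc].
have [a ca] : exists a, comul c = a *: tens c c.
  have : C c by rewrite Cc; exists 1; rewrite scale1r.
  move/CC; elim=> [|a _ y [u [v []]] + + -> _ [b ->]].
    by exists 0; rewrite scale0r.
  rewrite Cc => -[k ->] [l ->]; exists (a * (k * l) + b).
  rewrite (linear_Z _ _ ((tens_bilin H H).1 _)) (linear_Z _ _ ((tens_bilin H H).2 _)).
  by rewrite !scalerA scalerDl mulrA.
have ae : a * counit c = 1.
  have := lact_counit c; rewrite /lact /slicel ca.
  rewrite (linear_Z _ _ (tlift_lin (scale_bilin _ _))) tlift_pure; last exact: scale_bilin.
  rewrite scalerA => E; apply/eqP; rewrite -subr_eq0.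
  have /eqP : (a * counit c - 1) *: c = 0 by rewrite scalerBl scale1r E subrr.
  by rewrite scaler_eq0 (negPf c0) orbF.
exists (a *: c); first by rewrite Cc; exists a.
split; last by rewrite linearZ.
rewrite linearZ ca (linear_Z _ _ ((tens_bilin H H).1 _)).
by rewrite (linear_Z _ _ ((tens_bilin H H).2 _)).
Qed.

Lemma grouplike_lact f b : grouplike H b -> lact f b = f b *: b.
Proof.
by case=> cb _; rewrite /lact cb /slicel tlift_pure //; apply: scale_bilin.
Qed.

(** A minimal nonzero subcoalgebra is simple, hence one-dimensional. *)
Lemma pointed_grouplike (C : set H) : pointed H -> subcoalgebra C ->
  fin_dim C -> C <> [set 0]%classic -> exists2 b, C b & grouplike H b.
Proof.
move=> pH CC fC C0.
pose P (D : set H) := subcoalgebra D /\ D <> [set 0]%classic.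
have [|//|D [[DC D0] DsC Dmin]] := exists_minimal (P := P) _ _ fC.
  by move=> T [[]].
have [b Db gb] : exists2 b, D b & grouplike H b.
  apply: one_dim_grouplike => //; apply: pH; split=> // T TC TD.
  have [->|T0] := pselect (T = [set 0]%classic); first by left.
  by right; apply/seteqP; split=> //; apply: Dmin.
by exists b => //; apply: DsC.
Qed.

End Coalgebra.

(** * Semi-invariant vectors in pointed Hopf algebras *)

Section Pointed.
Context (K : fieldType) (H : hopfAlgType K).
Implicit Types (f g phi : {scalar H}) (h : H) (N W : set H).

Lemma lstable_lspan_orbit h :
  lstable (lspan [set lact f h | f in [set: {scalar H}]]%classic).
Proof.
move=> f x; elim=> [|a _ y [g _ <-] _ IH]; first by rewrite linear0; apply: lspan0.
by rewrite linearP; apply: lspanZD => //=; exists (g \o ract f) => //; rewrite -lact_lact.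
Qed.

Lemma fin_dim_lspan (S : set H) : fin_dim S -> fin_dim (lspan S).
Proof.
by move=> [s Ss]; exists s; apply: lspan_sub Ss; apply: subspace_lspan.
Qed.

Lemma fin_dim_racts N (Phi : set {scalar H}) : fin_dim N ->
  fin_dim [set x | exists phi v, [/\ Phi phi, N v & x = ract phi v]]%classic.
Proof.
move=> [s Ns]; have [c cP] := choice (@fin_dim_ract K H).
exists (flatten [seq c y | y <- s]) => _ [phi [v [_ /Ns sv ->]]].
elim: sv => [|a u w us _ IH]; first by rewrite linear0; apply: lspan0.
rewrite linearP; apply: (subspace_lspan _).2 => //.
have /cP : [set ract f u | f in [set: {scalar H}]]%classic (ract phi u).
  by exists phi.
apply: lspan_mono => z zc; apply/flattenP; exists (c u) => //.
exact: (map_f c us).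
Qed.

Definition annihilates phi W := forall y, W y -> phi y = 0.

(** The coefficient coalgebra of the left comodule [N / (N `&` W)]: its
    coefficients are the [v_1 phi(v_2)] for [v] in [N] and [phi] a form on the
    quotient. *)
Definition coef_space N W : set H :=
  lspan [set x | exists phi v, [/\ annihilates phi W, N v & x = ract phi v]]%classic.

Lemma coef_space_subcoalgebra N W : lstable W -> lstable N ->
  subcoalgebra (coef_space N W).
Proof.
move=> Wl Nl; apply/subcoalgebraP; split; first exact: subspace_lspan.
  move=> f x; elim=> [|a _ y [phi [v [phiW Nv ->]]] _ IH].
    by rewrite linear0; apply: lspan0.
  rewrite linearP; apply: lspanZD => //; exists phi, (lact f v).
  by split=> //; [apply: Nl | apply: lact_ract].
move=> f x; elim=> [|a _ y [phi [v [phiW Nv ->]]] _ IH].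
  by rewrite linear0; apply: lspan0.
rewrite linearP; apply: lspanZD => //; exists (phi \o lact f), v.
by split=> //; [move=> w Ww /=; apply/phiW/Wl | apply: ract_ract].
Qed.

Lemma coef_space_neq0 N W : subspace W -> ~ (N `<=` W)%classic ->
  coef_space N W <> [set 0]%classic.
Proof.
move=> WS NW C0; apply: NW => v Nv; apply: contrapT => Wv.
have [phi [phiv phiW]] := separating_form WS Wv.
have : coef_space N W (ract phi v) by apply: lspanS; exists phi, v.
rewrite C0 => /= r0; have := form_lact phi counit v.
by move/eqP; rewrite r0 linear0 lact_counit phiv oner_eq0.
Qed.

(** The hypothesis on [N] says that [N / (N `&` W)] is simple or zero. A form
    [phi] on it maps it to the coefficient coalgebra, [v |-> v_1 phi(v_2)], as
    comodules, so modulo [T] this map is injective or zero. It is not zero because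
    [b] is not in [T], and it maps [v] to the class of the semi-invariant [b];
    hence [v] is semi-invariant modulo [W]. *)
Lemma semi_invariant_vector N W T phi v b :
  subspace W -> lstable W -> subspace N -> lstable N ->
  (forall M, subspace M -> lstable M -> ~ (M `<=` W)%classic ->
     (M `<=` N)%classic -> (N `<=` M)%classic) ->
  subspace T -> lstable T -> annihilates phi W -> N v -> grouplike H b ->
  T (b - ract phi v) -> ~ T b ->
  ~ W v /\ forall f, W (lact f v - f b *: v).
Proof.
move=> WS Wl NS Nl Nmin TS Tl phiW Nv gb Tbv Tb.
pose M : set H := [set w | N w /\ T (ract phi w)]%classic.
have MS : subspace M.
  split=> [|a x y [Nx Tx] [Ny Ty]]; split.
  - exact: subspace0.
  - by rewrite linear0; apply: subspace0.
  - exact: NS.2.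
  - by rewrite linearP; apply: TS.2.
have Ml : lstable M.
  by move=> f w [Nw Tw]; split; [apply: Nl | rewrite -lact_ract; apply: Tl].
have MN : (M `<=` N)%classic by move=> w [].
have Mv : ~ M v by move=> [_ Tv]; apply: Tb; have := subspaceD TS Tbv Tv; rewrite subrK.
have MW : (M `<=` W)%classic.
  by apply: contrapT => NMW; apply: Mv; apply: (Nmin M).
split=> [Wv|f].
  apply: Mv; split=> //; have -> : ract phi v = 0; last exact: subspace0.
  by apply: forms_separate_points => e; rewrite -form_lact phiW //; apply: Wl.
apply: MW; split; first by apply: (subspaceB NS (Nl _ _ Nv)); apply: subspaceZ.
rewrite linearB linearZ /= -lact_ract.
have -> : lact f (ract phi v) - f b *: ract phi v =
    f b *: (b - ract phi v) - lact f (b - ract phi v).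
  by rewrite scalerBr (linearB (lact f)) /= (grouplike_lact f gb) opprB [RHS]addrC addrA subrK.
by apply: subspaceB => //; [apply: subspaceZ | apply: Tl].
Qed.

(** Every nonzero left comodule of a pointed Hopf algebra, here [H / W], contains
    a one-dimensional subcomodule. Take [N] minimal among the subcomodules not
    contained in [W]; its coefficient coalgebra contains a grouplike [b], and is
    spanned by the images of [N] under the maps [v |-> v_1 phi(v_2)]. Adding these
    images one at a time to the zero subspace, [b] is reached at some step, and
    [semi_invariant_vector] applies to the last image added. *)
Lemma pointed_semi_invariant W : pointed H -> subspace W -> lstable W ->
  W <> setT -> exists h b,
    [/\ ~ W h, grouplike H b & forall f, W (lact f h - f b *: h)].
Proof.
move=> pH WS Wl WT.
have [h0 Wh0] : exists h, ~ W h.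
  apply: contrapT => Nh; apply: WT; apply/seteqP; split=> // h _.
  by apply: contrapT => Wh; apply: Nh; exists h.
pose P N := [/\ subspace N, lstable N & ~ (N `<=` W)%classic].
pose S0 := lspan [set lact f h0 | f in [set: {scalar H}]]%classic.
have fS0 : fin_dim S0 by apply/fin_dim_lspan/fin_dim_lact_orbit.
have PS0 : P S0.
  split; [exact: subspace_lspan | exact: lstable_lspan_orbit | move=> S0W].
  apply: Wh0; apply: S0W; apply: lspanS; exists (counit : {scalar H}) => //.
  exact: lact_counit.
have [|N [[NS Nl NW] NS0 Nmin]] := exists_minimal (P := P) _ PS0 fS0.
  by move=> T [].
have fN : fin_dim N by have [s S0s] := fS0; exists s; apply: subset_trans S0s.
have CC := coef_space_subcoalgebra Wl Nl.
have [b Cb gb] : exists2 b, coef_space N W b & grouplike H b.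
  apply: pointed_grouplike => //; last exact: coef_space_neq0.
  apply/fin_dim_lspan/(@fin_dim_racts N (annihilates^~ W)) => //.
apply: contrapT => Nhb.
have step phi v T : annihilates phi W -> N v -> subspace T -> lstable T ->
    T (b - ract phi v) -> T b.
  move=> phiW Nv TS Tl Tbv; apply: contrapT => Tb; apply: Nhb; exists v, b.
  have [] // := semi_invariant_vector WS Wl NS Nl _ TS Tl phiW Nv gb Tbv Tb.
  by move=> M MS Ml MW MN; apply: Nmin.
(* Strip the terms of [x] one by one: each enlarges [T] by an image of [N], and
   [step] gets back from the enlarged subspace to [T]. *)
have key x T : coef_space N W x -> subspace T -> lstable T -> T (b - x) -> T b.
  move=> Cx; elim: Cx T => [|a _ y [phi [v [phiW Nv ->]]] _ IH] T TS Tl.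
    by rewrite subr0.
  move=> Tb; pose T' : set H := [set z | exists2 w, N w & T (z - ract phi w)]%classic.
  have T'S : subspace T'.
    split=> [|c z z' [w Nw Tw] [w' Nw' Tw']].
      exists 0; [exact: subspace0 | rewrite linear0 subr0; exact: subspace0].
    exists (c *: w + w'); first exact: NS.2.
    by rewrite linearP opprD addrACA -scalerBr; apply: TS.2.
  have T'l : lstable T'.
    move=> f z [w Nw Tw]; exists (lact f w); first exact: Nl.
    by rewrite -lact_ract -linearB; apply: Tl.
  have [|w Nw Tw] := IH T' T'S T'l.
    exists (a *: v); first exact: subspaceZ.
    by rewrite linearZ /= -addrA -opprD [y + _]addrC.
  exact: step phiW Nw TS Tl Tw.
have S0' : subspace [set 0 : H]%classic.
  by split=> // a u v -> ->; rewrite scaler0 addr0.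
have : [set 0 : H]%classic b.
  apply: (key b) => //; last by rewrite subrr.
  by move=> f h ->; rewrite linear0.
by move=> /= b0; have := oner_neq0 K; rewrite -gb.2 b0 linear0 eqxx.
Qed.

End Pointed.

(** * Grouplike elements form a group *)

Section Grouplike.
Context (K : fieldType) (H : hopfAlgType K).
Implicit Types (g h k : H).

Lemma linear_mull (A : algType K) (a : A) : linear (fun x => a * x).
Proof. exact: (mul_bilin A).2. Qed.
Lemma linear_mulr (A : algType K) (a : A) : linear (fun x => x * a).
Proof. exact: (mul_bilin A).1. Qed.

Lemma grouplike1 : grouplike H 1.
Proof. by split; [apply: comul1 | apply: counit1]. Qed.

Lemma sw_comul_mulr (W : lmodType K) (B : H -> H -> W) h g :
  grouplike H g -> bilin B ->
  tlift (comul (h * g)) B = \sw_(x, y <- comul h) B (x * g) (y * g).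
Proof.
move=> [cg _] BB; rewrite comulM cg.
etransitivity; first exact: (tlift_comp _ _ (tlift_lin BB)).
apply: eq_tlift => x y; rewrite tlift_pure ?tlift_pure //.
by apply: bilin_comp (tens_bilin _ _); apply: linear_mull.
Qed.

Lemma sw_comul_mull (W : lmodType K) (B : H -> H -> W) h g :
  grouplike H g -> bilin B ->
  tlift (comul (g * h)) B = \sw_(x, y <- comul h) B (g * x) (g * y).
Proof.
move=> [cg _] BB; rewrite comulM cg tlift_pure; last first.
  split=> [x|x]; apply: linear_sw => u v.
    by move=> a y z; rewrite mulrDl -scalerAl (tens_bilin H H).1.
  by move=> a y z; rewrite mulrDl -scalerAl (tens_bilin H H).2.
etransitivity; first exact: (tlift_comp _ _ (tlift_lin BB)).
by apply: eq_tlift => x y; rewrite tlift_pure.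
Qed.

Lemma grouplikeM g h : grouplike H g -> grouplike H h -> grouplike H (g * h).
Proof.
move=> gg gh; split; last by rewrite counitM gg.2 gh.2 mulr1.
rewrite -[LHS]tlift_tensK (sw_comul_mulr _ gh (tens_bilin _ _)) gg.1 tlift_pure //.
by apply: bilin_comp (tens_bilin _ _); apply: linear_mulr.
Qed.

Lemma antipode_bilinl : bilin (fun x y : H => antipode x * y).
Proof. by apply: bilin_comp (mul_bilin _) => // a x y; rewrite linearP. Qed.
Lemma antipode_bilinr : bilin (fun x y : H => x * antipode y).
Proof. by apply: bilin_comp (mul_bilin _) => // a x y; rewrite linearP. Qed.

Lemma grouplike_mulVg g : grouplike H g -> antipode g * g = 1.
Proof.
move=> [cg eg]; have := antipodel g; rewrite cg tlift_pure; last exact: antipode_bilinl.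
by rewrite eg scale1r.
Qed.
Lemma grouplike_mulgV g : grouplike H g -> g * antipode g = 1.
Proof.
move=> [cg eg]; have := antipoder g; rewrite cg tlift_pure; last exact: antipode_bilinr.
by rewrite eg scale1r.
Qed.

(** Multiplying the tensor [Delta(S g)] by [g (x) g] gives [Delta 1 = 1 (x) 1],
    whence [Delta(S g) = S g (x) S g] after multiplication by [S g (x) S g]. *)
Lemma grouplikeV g : grouplike H g -> grouplike H (antipode g).
Proof.
move=> gg; split; last first.
  by rewrite -(counit1 H) -(grouplike_mulVg gg) counitM gg.2 mulr1.
set s := antipode g.
have B1 : bilin (fun x y : H => tens (x * s) (y * s)).
  by apply: bilin_comp (tens_bilin _ _); apply: linear_mulr.
have : tlift (comul (s * g)) (fun x y => tens (x * s) (y * s)) = tens s s.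
  rewrite grouplike_mulVg // comul1 tlift_pure //.
  by rewrite (mul1r s).
rewrite (sw_comul_mulr _ gg B1) -[X in X = _ -> _]/(tlift _ _) => <-.
rewrite -[LHS]tlift_tensK; apply: eq_tlift => x y.
by rewrite -(mulrA x) -(mulrA y) grouplike_mulgV // (mulr1 x) (mulr1 y).
Qed.

Lemma grouplike_inv_uniq g g' : grouplike H g -> g * g' = 1 -> g' = antipode g.
Proof. by move=> gg E; rewrite -[g']mul1r -(grouplike_mulVg gg) -mulrA E mulr1. Qed.

(** Both [h |-> S(gh)g] and [S] are left convolution inverses of the identity, and
    the identity has [S] as right inverse: the middle expression is
    [S(g h_1) g h_2 S(h_3)]. *)
Lemma antipode_mull g h : grouplike H g -> antipode (g * h) * g = antipode h.
Proof.
move=> gg.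
transitivity (\sw_(x, y <- comul h) \sw_(x1, x2 <- comul x)
    (antipode (g * x1) * g * x2 * antipode y)).
  rewrite coassoc_sw.
  - transitivity (\sw_(x, y <- comul h) (counit y *: (antipode (g * x) * g))).
      rewrite -{1}(counitr h).
      have L : linear (fun h : H => antipode (g * h) * g).
        by move=> a x y; rewrite mulrDr -scalerAr linearP mulrDl -scalerAl.
      etransitivity; first exact: (tlift_comp _ _ L).
      by apply: eq_tlift => x y; rewrite -scalerAr linearZ /= -scalerAl.
    apply: eq_tlift => x y.
    transitivity (antipode (g * x) * g * (\sw_(y1, y2 <- comul y) (y1 * antipode y2))).
      by rewrite antipoder -scalerAr mulr1.
    etransitivity; first exact: (tlift_comp _ _ (linear_mull _)).
    by apply: eq_tlift => u v; rewrite mulrA.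
  - move=> u v a x y; rewrite mulrDr -scalerAr linearP !mulrDl.
    by rewrite -!scalerAl.
  - move=> x; apply: bilin_comp (mul_bilin _); first exact: linear_mull.
    by move=> a u v; rewrite linearP.
transitivity (\sw_(x, y <- comul h) (counit x *: antipode y)).
  apply: eq_tlift => x y.
  transitivity ((\sw_(x1, x2 <- comul x) (antipode (g * x1) * (g * x2))) * antipode y).
    symmetry; etransitivity; first exact: (tlift_comp _ _ (linear_mulr _)).
    by apply: eq_tlift => u v; rewrite !mulrA.
  rewrite -(sw_comul_mull x gg antipode_bilinl) antipodel counitM gg.2 mul1r.
  by rewrite -scalerAl mul1r.
rewrite -{2}(counitl h) (tlift_comp (f := antipode)); last by move=> a x y; rewrite linearP.
by apply: eq_tlift => x y; rewrite linearZ.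
Qed.

End Grouplike.

(** * Commutation rules in the partial Hopf algebra *)

Section Hpar.
Context (K : fieldType) (H : hopfAlgType K).
Implicit Types (g h k t : H).
Local Notation pbr := (@pbr K H).
Local Notation peps := (@peps K H).

Lemma pbr_linear : linear pbr. Proof. exact: pbr_is_linear. Qed.

Lemma pbr_bilin : bilin (fun x y : H => pbr x * pbr (antipode y)).
Proof.
apply: bilin_comp (mul_bilin _); first exact: pbr_linear.
by move=> a x y; rewrite linearP pbr_linear.
Qed.

Lemma peps_linear : linear peps.
Proof. by move=> a x y; rewrite /Defs.peps linearP (tlift_lin pbr_bilin). Qed.

Lemma peps_gl g : grouplike H g -> peps g = pbr g * pbr (antipode g).
Proof. by move=> [cg _]; rewrite /Defs.peps cg tlift_pure //; apply: pbr_bilin. Qed.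

Lemma peps1 : peps 1 = 1.
Proof.
rewrite peps_gl; last exact: grouplike1.
by rewrite pbr1 mul1r -[antipode 1]mulr1 grouplike_mulVg ?pbr1 //; apply: grouplike1.
Qed.

Lemma pbr_pbrV g h : grouplike H g ->
  pbr h * pbr g * pbr (antipode g) = pbr (h * g) * pbr (antipode g).
Proof.
move=> [cg _]; have := pbr_mull h g; rewrite cg tlift_pure ?tlift_pure //.
  apply: bilin_comp (mul_bilin _) => a x y; first by rewrite mulrDr -scalerAr pbr_linear.
  by rewrite linearP pbr_linear.
apply: bilin_comp (mul_bilin _) => a x y; last by rewrite linearP pbr_linear.
by rewrite pbr_linear mulrDr -scalerAr.
Qed.

Lemma pbrg_pbrV g h : grouplike H g ->
  pbr g * pbr (antipode g) * pbr h = pbr g * pbr (antipode g * h).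
Proof.
move=> [cg _]; have := pbr_mulr g h; rewrite cg tlift_pure ?tlift_pure //.
  apply: bilin_comp (mul_bilin _) => a x y; first by rewrite pbr_linear.
  by rewrite linearP mulrDl -scalerAl pbr_linear.
exact: (linear_bilin (linear_mulr (pbr h)) pbr_bilin).
Qed.

(** By the relation [pbr_mulr], the right-hand side is
    [[h_1][S(h_2) h_3 k] = [h][k]]. *)
Lemma pbr_mul_peps h k :
  pbr h * pbr k = \sw_(x, y <- comul h) (peps x * pbr (y * k)).
Proof.
symmetry; transitivity (\sw_(x, y <- comul h) \sw_(x1, x2 <- comul x)
    (pbr x1 * pbr (antipode x2 * (y * k)))).
  apply: eq_tlift => x y; rewrite -pbr_mulr /Defs.peps.
  exact: (tlift_comp _ _ (linear_mulr _)).
rewrite coassoc_sw.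
- transitivity (\sw_(x, y <- comul h) (counit y *: (pbr x * pbr k))).
    apply: eq_tlift => x y.
    have L : linear (fun z => pbr x * pbr (z * k)).
      by move=> a u v; rewrite mulrDl -scalerAl pbr_linear mulrDr -scalerAr.
    transitivity (pbr x * pbr ((\sw_(y1, y2 <- comul y) (antipode y1 * y2)) * k)).
      symmetry; etransitivity; first exact: (tlift_comp _ _ L).
      by apply: eq_tlift => u v; rewrite mulrA.
    by rewrite antipodel -scalerAl mul1r (linear_Z _ _ pbr_linear) -scalerAr.
  rewrite -{2}(counitr h).
  have L : linear (fun z => pbr z * pbr k).
    by move=> a u v; rewrite pbr_linear mulrDl -scalerAl.
  symmetry; etransitivity; first exact: (tlift_comp _ _ L).
  by apply: eq_tlift => x y; rewrite (linear_Z _ _ pbr_linear) -scalerAl.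
- by move=> y z a u v; rewrite pbr_linear mulrDl -scalerAl.
- move=> x; apply: (linear_bilin (f := fun z => pbr x * pbr z) (B := fun y z => antipode y * (z * k))).
    by move=> a u v; rewrite pbr_linear mulrDr -scalerAr.
  apply: bilin_comp (mul_bilin _); last exact: linear_mulr.
  by move=> a u v; rewrite linearP.
Qed.

(** [[h] eps_t = [ht][t^-1]], to which [pbr_mul_peps] applies. *)
Lemma pbr_peps_gl h t : grouplike H t ->
  pbr h * peps t = \sw_(x, y <- comul h) (peps (x * t) * pbr y).
Proof.
move=> gt; rewrite peps_gl // mulrA pbr_pbrV // pbr_mul_peps.
rewrite (sw_comul_mulr _ gt).
  by apply: eq_tlift => x y; rewrite -mulrA grouplike_mulgV // mulr1.
apply: bilin_comp (mul_bilin _); first exact: peps_linear.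
by move=> a u v; rewrite mulrDl -scalerAl pbr_linear.
Qed.

(** Both sides are [[g k_1][S(k_2)]], by the two defining relations. *)
Lemma gl_pbr_peps g k : grouplike H g -> pbr g * peps k = peps (g * k) * pbr g.
Proof.
move=> gg; transitivity (\sw_(x, y <- comul k) (pbr (g * x) * pbr (antipode y))).
  rewrite -pbr_mull; etransitivity; first exact: (tlift_comp _ _ (linear_mull _)).
  by apply: eq_tlift => x y; rewrite mulrA.
symmetry; transitivity (\sw_(x, y <- comul (g * k)) (pbr x * pbr (antipode y * g))).
  rewrite -pbr_mulr; exact: (tlift_comp _ _ (linear_mulr _)).
rewrite (sw_comul_mull _ gg).
  by apply: eq_tlift => x y; rewrite antipode_mull.
apply: bilin_comp (mul_bilin _); first exact: pbr_linear.
by move=> a u v; rewrite linearP mulrDl -scalerAl pbr_linear.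
Qed.

(** Moving [eps_k] through [[g^-1]] and then through [[g]] translates it by [g^-1],
    then by [g]. *)
Lemma peps_gl_comm g k : grouplike H g -> GRing.comm (peps g) (peps k).
Proof.
move=> gg; rewrite /GRing.comm peps_gl // -mulrA.
rewrite gl_pbr_peps; last exact: grouplikeV.
by rewrite mulrA gl_pbr_peps // !mulrA grouplike_mulgV // mul1r.
Qed.

Lemma peps_gl_idem g : grouplike H g -> peps g * peps g = peps g.
Proof.
move=> gg; rewrite {2}peps_gl // mulrA peps_gl //.
by rewrite pbrg_pbrV // grouplike_mulVg // pbr1 mulr1.
Qed.

(** [H_par] is generated as an algebra by the classes of elements of [H]: unwinding
    the two quotients leaves the monomials of a free algebra. *)
Lemma hpar_ind (P : hpar H -> Prop) :
  (forall a x y, P x -> P y -> P (a *: x + y)) ->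
  (forall x y, P x -> P y -> P (x * y)) -> P 1 -> (forall h, P (pbr h)) ->
  forall x, P x.
Proof.
move=> PL PM P1 Pb x; rewrite -[x]ireprK; move: (irepr x) => {}x.
rewrite -[x]ireprK; move: (irepr x) => {x} m.
have P0 : P 0 by have := PL (-1) 1 1 P1 P1; rewrite scaleN1r addNr.
pose F (m : free_alg H) : hpar H := iproj (@hpar_rel K H) (iproj (@talg_rel K H) m).
rewrite -/(F m).
have FL : linear F.
  move=> a u v; rewrite /F (iproj_is_linear (@talg_rel K H)).
  exact: (iproj_is_linear (@hpar_rel K H)).
have FM u v : F (u * v) = F u * F v.
  by rewrite /F (@iprojM K _ (@talg_rel K H)) (@iprojM K _ (@hpar_rel K H)).
have PF w : P (F << w >>).
  have [v ->] : exists v : seq H, w = FMonom v by case: w => v; exists v.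
  elim: v => [|h v IH].
    have -> : << FMonom [::] >> = 1 :> free_alg H by rewrite -fmoneE.
    exact: P1.
  have -> : << FMonom (h :: v) >> = fgen h * << FMonom v >> :> free_alg H.
    have -> : FMonom (h :: v) = fmmul (fmu h) (FMonom v) by rewrite fmuE fmmulE.
    by rewrite /fgen malgM_def fgmulUU mulr1.
  rewrite FM; apply: PM IH; exact: Pb.
rewrite (monalgE m); elim/big_ind: _ => [|u v Pu Pv|w _].
- by rewrite (linear_0 FL).
- by rewrite (linear_D _ _ FL) -[F u]scale1r; apply: PL.
have -> : << m@_w *g w >> = m@_w *: << w >> :> free_alg H.
  by apply/malgP => q; rewrite mcoeffZ !mcoeffU mulrnAr mulr1.
by rewrite (linear_Z _ _ FL) -[_ *: _]addr0; apply: PL.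
Qed.


End Hpar.

(** * The idempotents attached to sets of grouplike elements *)

Section Products.
Context (A : nzRingType) (I : eqType) (F : I -> A).

Lemma prod_mul_factor (r : seq I) (x : I) :
  x \in r -> F x * F x = F x -> (forall i, i \in r -> GRing.comm (F x) (F i)) ->
  \prod_(i <- r) F i * F x = \prod_(i <- r) F i.
Proof.
move=> + Fx; elim: r => //= y r IH; rewrite inE big_cons => xr Fc.
have Fr : forall i, i \in r -> GRing.comm (F x) (F i).
  by move=> i ir; apply: Fc; rewrite inE ir orbT.
case/orP: xr => [/eqP <-|xr]; last by rewrite -mulrA IH.
have <- : GRing.comm (F x) (F x * \prod_(i <- r) F i).
  by apply: commrM => //; rewrite big_seq; apply: commr_prod.
by rewrite mulrA Fx.
Qed.

Lemma mul_prod_id (r : seq I) (p : A) :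
  (forall i, i \in r -> p * F i = p) -> p * \prod_(i <- r) F i = p.
Proof.
move=> pF; rewrite big_seq; elim/big_rec: _ => [|i a ir IH]; first by rewrite mulr1.
by rewrite mulrA pF.
Qed.
End Products.

Section Blocks.
Context (K : fieldType) (H : hopfAlgType K).
Hypothesis Gfin : finite_set (grouplike H).
Local Notation G := (glset H).
Local Notation peps := (@peps K H).
Local Notation pbr := (@pbr K H).
Implicit Types (X Y Z : {fset H}) (g h t : H).

Lemma glsetP g : reflect (grouplike H g) (g \in G).
Proof.
by rewrite /glset in_fset_set //; apply: (iffP idP) => [/set_mem|/mem_set].
Qed.

Lemma glset1 : 1 \in G. Proof. exact/glsetP/grouplike1. Qed.

Lemma in_P1 X : reflect (X `<=` G /\ 1 \in X) (X \in P1 H).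
Proof.
by rewrite !inE fpowersetE; apply: (iffP andP).
Qed.

(** This holds for all [h] in [H], although the [eps_h] need not commute with each
    other. *)
Lemma peps_PX_comm X h : X `<=` G -> GRing.comm (peps h) (PX X).
Proof.
move=> /fsubsetP XG; apply: commrM; rewrite big_seq; apply: commr_prod => x xX.
  by apply/commr_sym/peps_gl_comm/glsetP/XG.
apply: commrB; first exact: commr1.
by apply/commr_sym/peps_gl_comm/glsetP; move: xX; rewrite inE => /andP[].
Qed.

Lemma peps_complement_idem t : grouplike H t ->
  (1 - peps t) * (1 - peps t) = 1 - peps t.
Proof.
by move=> gt; rewrite mulrBr mulr1 mulrBl mul1r peps_gl_idem // subrr subr0.
Qed.

Lemma PX_peps X t : X `<=` G -> t \in G ->
  PX X * peps t = if t \in X then PX X else 0.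
Proof.
move=> /fsubsetP XG tG; have gt := glsetP _ tG.
have ct h : GRing.comm (peps t) (peps h) by apply: peps_gl_comm.
case: ifP => tX.
  have tP : GRing.comm (peps t) (\prod_(y <- G `\` X) (1 - peps y)).
    by apply: commr_prod => y _; apply: commrB => //; apply: commr1.
  rewrite /PX -mulrA -tP mulrA prod_mul_factor //.
  exact: peps_gl_idem.
have tGX : t \in G `\` X by rewrite inE tX.
rewrite /PX -(@prod_mul_factor _ _ (fun y => 1 - peps y) _ t tGX).
- by rewrite -!mulrA mulrBl mul1r peps_gl_idem // subrr !mulr0.
- exact: peps_complement_idem.
- move=> i _; apply/commr_sym/commrB; first exact: commr1.
  by apply/commr_sym/commrB; [apply: commr1 | apply: ct].
Qed.

Lemma peps_PX X t : X `<=` G -> t \in G ->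
  peps t * PX X = if t \in X then PX X else 0.
Proof. by move=> XG tG; rewrite peps_PX_comm // PX_peps. Qed.

Lemma PX_idem X : X `<=` G -> PX X * PX X = PX X.
Proof.
move=> XG; have XG' := fsubsetP XG; rewrite {2}/PX mulrA (@mul_prod_id _ _ _ X) => [|i iX].
  rewrite mul_prod_id // => i; rewrite inE => /andP[/negPf iX iG].
  by rewrite mulrBr mulr1 PX_peps // iX subr0.
by rewrite PX_peps ?iX //; apply: XG'.
Qed.

Lemma PX_orth X Y : X `<=` G -> Y `<=` G -> X <> Y -> PX X * PX Y = 0.
Proof.
move=> XG YG XY.
have E t : t \in G -> (t \in X) != (t \in Y) -> PX X * PX Y = 0.
  move=> tG; have := congr1 ( *%R^~ (PX Y)) (PX_peps XG tG).
  rewrite /= -mulrA peps_PX //.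
  by case: (t \in X); case: (t \in Y); rewrite ?mulr0 ?mul0r // => <-.
apply: contrapT => NP; apply: XY; apply/fsetP => t; apply/eqP; apply: contrapT => /negP tXY.
apply: NP; apply: (E t) => //.
have [tX|tX] := boolP (t \in X); first exact: (fsubsetP XG).
by move: tXY; rewrite (negPf tX); case: (boolP (t \in Y)) => // tY _; apply: (fsubsetP YG).
Qed.

Lemma PX_eq0 X : X `<=` G -> 1 \notin X -> PX X = 0.
Proof.
move=> XG /negPf X1; rewrite -[PX X]mulr1 -(peps1 H) PX_peps ?X1 //.
exact: glset1.
Qed.

(** For each grouplike [t], an element is the sum of its multiples by [eps_t] and
    [1 - eps_t]. So it vanishes if it is killed by every product that has, for each
    [t], one of these two factors; and such a product is a multiple of a [P_X]. *)
Lemma PX_jointly_faithful (a : hpar H) :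
  (forall X, X `<=` G -> PX X * a = 0) -> a = 0.
Proof.
move=> Pa.
pose c X t := if t \in X then peps t else 1 - peps t.
(* The product of the [c X t] is fixed by every factor of [PX X]. *)
have cPX X : X `<=` G -> (\prod_(t <- G) c X t) * a = 0.
  move=> XG; set q := \prod_(t <- G) c X t.
  have cc t s : t \in G -> GRing.comm (c X t) (c X s).
    move=> /glsetP gt; have cts := peps_gl_comm s gt.
    have c1 h : GRing.comm (peps h) 1 by apply: commr1.
    rewrite /c; case: ifP => _; case: ifP => _ //; try exact: commrB.
      by apply/commr_sym/commrB => //; apply: commr_sym.
    apply/commr_sym/commrB; first exact: commr1.
    by apply/commr_sym/commrB => //; apply: commr1.
  have qc t : t \in G -> q * c X t = q.
    move=> tG; apply: prod_mul_factor => // [|s _]; last exact: cc.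
    have gt := glsetP _ tG; rewrite /c; case: ifP => _; first exact: peps_gl_idem.
    exact: peps_complement_idem.
  have -> : q = q * PX X.
    rewrite /PX mulrA (@mul_prod_id _ _ _ X) => [|i iX].
      rewrite mul_prod_id // => i; rewrite inE => /andP[/negPf iX iG].
      by have := qc i iG; rewrite /c iX.
    by have := qc i (fsubsetP XG i iX); rewrite /c iX.
  by rewrite -mulrA Pa // mulr0.
have split_r (r : seq H) : uniq r -> {subset r <= G} ->
    (forall X, X `<=` G -> \prod_(t <- r) c X t * a = 0) -> a = 0.
  elim: r => [|t r IH] /=; first by move=> _ _ /(_ _ (fsub0set _)); rewrite big_nil mul1r.
  move=> /andP[tr ur] rG ca; apply: IH => // [s sr|X XG].
    by apply: rG; rewrite inE sr orbT.
  have tG : t \in G by apply: rG; rewrite inE eqxx.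
  have cr Y : (forall s, s != t -> (s \in Y) = (s \in X)) ->
      \prod_(s <- r) c Y s = \prod_(s <- r) c X s.
    move=> YX; apply: eq_big_seq => s sr; rewrite /c YX //.
    by apply: contraNneq tr => <-.
  have X1G : t |` X `<=` G by rewrite fsubUset fsub1set tG.
  have X0G : X `\ t `<=` G by apply: fsubset_trans XG; apply: fsubD1set.
  have E1 := ca _ X1G; have E0 := ca _ X0G; move: E1 E0; rewrite !big_cons.
  rewrite (cr (t |` X)) => [|s /negPf st]; last by rewrite !inE st.
  rewrite (cr (X `\ t)) => [|s /negPf st]; last by rewrite !inE st.
  rewrite /c !inE eqxx /= -!mulrA => E1 E0.
  by rewrite -[LHS]mul1r -[X in X * _](subrK (peps t)) mulrDl E0 E1 addr0.
exact: (split_r G (fset_uniq G)).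
Qed.

Lemma sum_PX : \sum_(X <- P1 H) PX X = 1 :> hpar H.
Proof.
apply/esym/eqP; rewrite -subr_eq0; apply/eqP/PX_jointly_faithful => X XG.
have [X1|X1] := boolP (1 \in X); last by rewrite PX_eq0 // mul0r.
have XP : X \in P1 H by apply/in_P1.
rewrite mulrBr mulr1 mulr_sumr (big_fsetD1 X) //= PX_idem // big_seq big1 ?addr0 ?subrr //.
move=> Y; rewrite in_fsetD1 => /andP[/eqP YX /in_P1[YG _]].
by apply: PX_orth => // XY; apply: YX.
Qed.

Lemma peq_sym X Y : X \in P1 H -> peq X Y -> peq Y X.
Proof.
move=> /in_P1[_ X1] [g gG [[g' [gg' g'g] g'X] <-]].
have g'G : g' \in G.
  by rewrite (grouplike_inv_uniq (glsetP _ gG) gg'); apply/glsetP/grouplikeV/glsetP.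
exists g' => //; split.
  by exists g; [split | apply/imfsetP; exists 1; rewrite ?mulr1].
apply/fsetP => x; apply/imfsetP/idP => /= [[_ /imfsetP[y /= yX ->] ->]|xX].
  by rewrite mulrA g'g mul1r.
exists (g * x); last by rewrite mulrA g'g mul1r.
by apply/imfsetP; exists x.
Qed.

Lemma peq_trans X Y Z : peq X Y -> peq Y Z -> peq X Z.
Proof.
move=> [g gG [[g' [gg' g'g] g'X] <-]] [h hG [[h' [hh' h'h] h'Y] <-]].
exists (h * g); first by apply/glsetP/grouplikeM; apply/glsetP.
split.
  exists (g' * h').
    by rewrite -mulrA (mulrA g) gg' mul1r -mulrA (mulrA h') h'h mul1r.
  by case/imfsetP: h'Y => x /= xX ->; rewrite mulrA g'g mul1r.
apply/fsetP => x; apply/imfsetP/imfsetP => /= [[y yX ->]|[_ /imfsetP[y /= yX ->] ->]].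
  by exists (g * y); rewrite ?mulrA //; apply/imfsetP; exists y.
by exists y; rewrite ?mulrA.
Qed.

Lemma peq_translate X Y b : X \in P1 H -> Y \in P1 H -> b \in G ->
  (forall t, t \in G -> (b * t \in Y) = (t \in X)) -> peq X Y.
Proof.
move=> /in_P1[XG X1] /in_P1[YG Y1] bG XY; have gb := glsetP _ bG.
have VG t : t \in G -> antipode b * t \in G.
  by move=> /glsetP gt; apply/glsetP/grouplikeM => //; apply: grouplikeV.
exists b => //; split.
  exists (antipode b); first by rewrite grouplike_mulgV // grouplike_mulVg.
  by rewrite -[antipode b]mulr1 -XY ?VG ?glset1 // mulrA grouplike_mulgV // mul1r.
apply/fsetP => y; apply/imfsetP/idP => /= [[x xX ->]|yY].
  by rewrite XY // (fsubsetP XG).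
exists (antipode b * y); last by rewrite mulrA grouplike_mulgV // mul1r.
by rewrite -XY ?VG ?(fsubsetP YG) // mulrA grouplike_mulgV // mul1r.
Qed.

(** The map [E h = P_Y [h] P_X] vanishes as soon as [X] and [Y] are not equivalent.
    Let [W] be the largest left coideal on which [E] vanishes. If [W] is not the
    whole of [H], there are [k] outside [W] and a grouplike [b] with
    [Delta k - b (x) k] in [H (x) W]. Then [[k] eps_t = eps_(k_1 t)[k_2]] gives
    [E k * eps_t = eps_(bt) * E k] for every grouplike [t], the terms in
    [H (x) W] being killed. As [P_X] and [P_Y] are eigenvectors of the [eps_t] with
    eigenvalues 0 and 1 that record membership in [X] and [Y], and [E k] is not
    zero, [t] is in [X] exactly when [bt] is in [Y]; that is, [Y = bX]. *)
Lemma PX_pbr_PX_eq0 (pH : pointed H) X Y h : X \in P1 H -> Y \in P1 H ->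
  ~ peq X Y -> PX Y * pbr h * PX X = 0.
Proof.
move=> XP YP XY; have [XG _] := in_P1 _ XP; have [YG _] := in_P1 _ YP.
pose E h := PX Y * pbr h * PX X.
have EL : linear E.
  by move=> a x y; rewrite /E pbr_linear mulrDr mulrDl -scalerAr -scalerAl.
pose W : set H := [set h | forall f : {scalar H}, E (lact f h) = 0]%classic.
have WE k : W k -> E k = 0.
  by move=> /(_ (counit : {scalar H})); rewrite lact_counit.
have WS : subspace W.
  split=> [f|a x y Wx Wy f]; first by rewrite linear0 (linear_0 EL).
  by rewrite linearP EL Wx Wy scaler0 addr0.
have Wl : lstable W.
  by move=> f k Wk g; rewrite lact_lact; apply: (Wk (f \o ract g)).
apply: contrapT => Eh.
have WT : W <> setT by move=> WT; apply: Eh; apply: (WE h); rewrite WT.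
have [k [b [Wk gb kb]]] := pointed_semi_invariant pH WS Wl WT.
(* Semi-invariance propagates [E k = 0] to the whole coideal generated by [k]. *)
have Ek : E k <> 0.
  move=> Ek; apply: Wk => f; have /WE := kb f.
  by rewrite addrC -scaleNr EL Ek scaler0 add0r.
apply: XY; apply: (@peq_translate _ _ b) => // [|t tG]; first exact/glsetP.
have gt := glsetP _ tG.
have btG : b * t \in G by apply/glsetP/grouplikeM.
pose B (x y : H) := peps (x * t) * E y.
have BB : bilin B.
  apply: bilin_comp (mul_bilin _) => // a x y.
  by rewrite mulrDl -scalerAl peps_linear.
have BC : E k * peps t = \sw_(x, y <- comul k) B x y.
  rewrite /E -(mulrA _ (PX X)) -(peps_PX_comm _ XG) mulrA -(mulrA (PX Y)) pbr_peps_gl //.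
  have L : linear (fun z => PX Y * z * PX X).
    by move=> a u v; rewrite mulrDr mulrDl -scalerAr -scalerAl.
  etransitivity; first exact: (tlift_comp _ _ L).
  by apply: eq_tlift => x y; rewrite /B /E (mulrA (PX Y)) -(peps_PX_comm (x * t) YG) -!mulrA.
have tb : \sw_(x, y <- comul k) B x y = B b k.
  have BL := tlift_lin BB.
  rewrite -(tlift_pure b k BB); apply/eqP; rewrite -subr_eq0; apply/eqP.
  rewrite -(linear_B _ _ BL); apply: (tlift_slicel_eq0 BB WS) => [f|u v /WE Ev].
    rewrite /slicel (linear_B _ _ (tlift_lin (scale_bilin f H))).
    rewrite (tlift_pure b k (scale_bilin f H)); exact: kb.
  by rewrite /B Ev mulr0.
have EX : E k * peps t = if t \in X then E k else 0.
  by rewrite /E -(mulrA _ (PX X)) PX_peps //; case: ifP => // _; rewrite mulr0.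
have EY : B b k = if b * t \in Y then E k else 0.
  rewrite /B /E (mulrA (peps (b * t)) (PX Y * pbr k)) (mulrA (peps (b * t)) (PX Y)).
  by rewrite peps_PX //; case: ifP => // _; rewrite !mul0r.
move: BC; rewrite tb EX EY.
by case: ifP => _; case: ifP => _ // E0; exfalso; apply: Ek.
Qed.

End Blocks.

(** * The elements Gamma are central idempotents *)

Section Central.
Context (K : fieldType) (H : hopfAlgType K).
Hypothesis Gfin : finite_set (grouplike H).
Hypothesis pH : pointed H.
Local Notation pbr := (@pbr K H).
Implicit Types (X Y Z : {fset H}) (h : H).

(** This is [1 - Gamma X], written as a sum of blocks. *)
Definition coGamma X : hpar H := \sum_(Y <- P1 H | ~~ `[< peq Y X >]) PX Y.

Lemma Gamma_coGamma X : Gamma X + coGamma X = 1.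
Proof. by rewrite -(sum_PX Gfin) (bigID (fun Y => `[< peq Y X >])). Qed.

Lemma Gamma_pbr_coGamma X h : X \in P1 H ->
  Gamma X * pbr h * coGamma X = 0.
Proof.
move=> XP; rewrite /Gamma /coGamma !mulr_suml big_seq_cond big1 // => Y.
move=> /andP[YP /asboolP YX]; rewrite mulr_sumr big_seq_cond big1 // => Z.
move=> /andP[ZP /asboolP ZX]; apply: PX_pbr_PX_eq0 => // ZY; apply: ZX.
exact: peq_trans ZY YX.
Qed.

Lemma coGamma_pbr_Gamma X h : X \in P1 H ->
  coGamma X * pbr h * Gamma X = 0.
Proof.
move=> XP; rewrite /Gamma /coGamma !mulr_suml big_seq_cond big1 // => Y.
move=> /andP[YP /asboolP YX]; rewrite mulr_sumr big_seq_cond big1 // => Z.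
move=> /andP[ZP /asboolP ZX]; apply: PX_pbr_PX_eq0 => // ZY; apply: YX.
by apply: peq_trans ZX => //; apply: peq_sym.
Qed.

(** With [e = Gamma X], both sides equal [e [h] e], since [(1 - e)[h]e] and
    [e[h](1 - e)] are sums of elements [P_Y [h] P_Z] with [Y] and [Z] not
    equivalent. *)
Lemma Gamma_pbr X h : X \in P1 H -> pbr h * Gamma X = Gamma X * pbr h.
Proof.
move=> XP; rewrite -[LHS]mul1r -[RHS]mulr1 -(Gamma_coGamma X).
rewrite mulrDl mulrDr !(mulrA _ (pbr h)) coGamma_pbr_Gamma //.
by rewrite Gamma_pbr_coGamma.
Qed.

Lemma Gamma_central X a : X \in P1 H -> a * Gamma X = Gamma X * a.
Proof.
move=> XP; elim/hpar_ind: a => [c x y Ex Ey|x y Ex Ey||h].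
- by rewrite mulrDl mulrDr -scalerAl -scalerAr Ex Ey.
- by rewrite -mulrA Ey !mulrA Ex.
- by rewrite mul1r mulr1.
- exact: Gamma_pbr.
Qed.

Lemma Gamma_idem X : X \in P1 H -> Gamma X * Gamma X = Gamma X.
Proof.
move=> XP; have := Gamma_pbr_coGamma 1 XP; rewrite pbr1 mulr1 => E.
by rewrite -[RHS]mulr1 -(Gamma_coGamma X) mulrDr E addr0.
Qed.

Lemma Gamma_orth X Y : X \in P1 H -> ~ peq X Y -> Gamma X * Gamma Y = 0.
Proof.
move=> XP XY; rewrite /Gamma mulr_suml big_seq_cond big1 // => Z.
move=> /andP[ZP /asboolP ZX]; rewrite mulr_sumr big_seq_cond big1 // => Z'.
move=> /andP[ZP' /asboolP ZY].
have [ZG _] := in_P1 _ ZP; have [ZG' _] := in_P1 _ ZP'.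
apply: PX_orth => // ZZ; apply: XY; apply: (@peq_trans _ _ Gfin _ Z).
  exact: peq_sym.
by rewrite ZZ.
Qed.

Lemma sum_Gamma (n : nat) (X : 'I_n -> {fset H}) :
  complete_representatives X -> \sum_(k < n) Gamma (X k) = 1.
Proof.
move=> [XP Xex Xuniq]; rewrite -(sum_PX Gfin) /Gamma.
under eq_bigr => k _ do rewrite big_mkcond.
rewrite exchange_big /=; apply: eq_big_seq => Y YP.
have [k Yk] := Xex Y YP; rewrite -big_mkcond (big_pred1 k) // => l.
apply/asboolP/eqP => [Yl|-> //]; apply: Xuniq.
by apply: peq_trans Yk => //; apply: peq_sym.
Qed.

End Central.

Theorem theorem2p12 (K : fieldType) (H : hopfAlgType K)
    (Hpointed : pointed H)
    (Hantipode : bijective (@antipode K H))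
    (Hfinite : finite_set (grouplike H))
    (n : nat) (X : 'I_n -> {fset H}%type)
    (HX : complete_representatives X) :
  direct_sum (fun k => left_principal (Gamma (X k))) /\
  (forall k, two_sided_ideal (left_principal (Gamma (X k)))).
Proof.
have [XP _ Xuniq] := HX.
have XC k a := Gamma_central Hfinite Hpointed a (XP k).
have XI k := Gamma_idem Hfinite Hpointed (XP k).
split=> [v|k].
  exists [ffun k => v * Gamma (X k)]; split.
    split=> [k|]; first by rewrite ffunE; exists v.
    under eq_bigr => k _ do rewrite ffunE.
    by rewrite -mulr_sumr sum_Gamma // mulr1.
  move=> w [wX ->]; apply/ffunP => k; rewrite ffunE mulr_suml (bigD1 k) //=.
  have [a ->] := wX k; rewrite -mulrA XI big1 ?addr0 // => l lk.
  have [b ->] := wX l; rewrite -mulrA Gamma_orth ?mulr0 // => /Xuniq E.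
  by rewrite E eqxx in lk.
split=> [|_ _ [a ->] [b ->]|c _ [a ->]|c _ [a ->]].
- by exists 0; rewrite mul0r.
- by exists (a + b); rewrite mulrDl.
- by exists (c * a); rewrite mulrA.
- by exists (a * c); rewrite -mulrA -XC mulrA.
Qed.
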